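(* Let $N\ge1$ and let $g$ be a centrally symmetric interaction kernel on $\mathbb{R}^N$ (with $g(x)=g(-x)$) such that: (i) $g$ is bounded from below, lower semicontinuous and belongs to $L^1_{\rm loc}(\mathbb{R}^N)$; (ii) $\liminf_{|x|\to\infty}g(x)\ge0$; (iii) there exists $\mu_0\in\mathcal{P}(\mathbb{R}^N)$ with $\mathcal{E}(\mu_0)<0$. Let $m_n=\inf_{\mathcal{P}(\mathbb{R}^N)}\mathcal{E}_n$ and $\ell_P=\liminf_{n\to\infty}m_n$. Then $$\ell_P=\lim_{n\to\infty}m_n=\inf\{\mathcal{E}(\mu):\mu\in\mathcal{P}(\mathbb{R}^N)\}.$$ Additionally, any sequence $\{\pi_n\}\subset\mathcal{P}(\mathbb{R}^N)$ with $\lim_{n\to\infty}\mathcal{E}_n(\pi_n)=\ell_P$ is, up to translations, precompact in $\mathcal{P}(\mathbb{R}^N)$ with respect to weak-$*$ convergence, and any limit point is a minimizer of $\mathcal{E}$ in $\mathcal{P}(\mathbb{R}^N)$.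
   Context: $\mathcal{P}(\mathbb{R}^N)$ is the set of Borel probability measures on $\mathbb{R}^N$. The kernel $g$ takes real values on $\mathbb{R}^N\setminus\{0\}$ and $g(0)\in(-\infty,+\infty]$. Weak-$*$ convergence $\mu_n\to\mu$ in $\mathcal{P}(\mathbb{R}^N)$ means $\int\phi\,d\mu_n\to\int\phi\,d\mu$ for every continuous compactly supported $\phi:\mathbb{R}^N\to\mathbb{R}$. The continuum energy is $\mathcal{E}(\mu)=\int_{\mathbb{R}^N}\int_{\mathbb{R}^N}g(x-y)\,d\mu(x)\,d\mu(y)\in(-\infty,+\infty]$ for $\mu\in\mathcal{P}(\mathbb{R}^N)$. An $n$-discrete probability measure is a measure of the form $\frac1n\sum_{i=1}^n\delta_{x_i}$ with $x_1,\dots,x_n\in\mathbb{R}^N$ (not necessarily distinct). For $n\ge1$ the discrete energy $\mathcal{E}_n:\mathcal{P}(\mathbb{R}^N)\to(-\infty,+\infty]$ is $$\mathcal{E}_n(\mu)=\frac1{n^2}\sum_{1\le i\ne j\le n}g(x_i-x_j)\quad\text{if }\mu=\frac1n\sum_{i=1}^n\delta_{x_i},$$ and $\mathcal{E}_n(\mu)=+\infty$ if $\mu$ is not $n$-discrete. ''Precompact up to translations'' means: there are vectors $y_n\in\mathbb{R}^N$ such that every subsequence of the translated measures $\pi_n(\cdot+y_n)$ has a further subsequence converging weakly-$*$ to an element of $\mathcal{P}(\mathbb{R}^N)$. A ''limit point'' is a weak-$*$ limit in $\mathcal{P}(\mathbb{R}^N)$ of a subsequence of the (translated) sequence. *)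

(* Defs.v *)
From HB Require Import structures.
From mathcomp Require Import all_boot all_order all_algebra perm.
From mathcomp Require Import all_classical all_reals all_analysis.
From mathcomp Require Import measurable_realfun.

Set Implicit Arguments.
Unset Strict Implicit.
Unset Printing Implicit Defensive.

Import Order.TTheory GRing.Theory Num.Theory.
Import numFieldNormedType.Exports.

Local Open Scope classical_set_scope.
Local Open Scope ring_scope.
Local Open Scope ereal_scope.

(* R^N is 'rV[R]_N, with the (product) topology of the library; its norm is the
   sup norm.  [borel_rV R N] is the same type with its Borel sigma-algebra. *)
Notation borel_rV R N := (g_sigma_algebraType (@open 'rV[R]_N)).

Section euclidean_space.
Context {R : realType} {N : nat}.

(* Complements of balls.  All norms on 'rV[R]_N give the same filter. *)
Definition at_infinity : set_system 'rV[R]_N :=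
  filter_from [set: R] (fun r => [set x | (r < `|x|)%R]).

Definition subrV (y x : borel_rV R N) : borel_rV R N :=
  ((x : 'rV[R]_N) - (y : 'rV[R]_N))%R.

Lemma measurable_subrV y : measurable_fun [set: borel_rV R N] (subrV y).
Proof.
apply: (@measurability _ _ (borel_rV R N) (borel_rV R N) _ _
  (@open 'rV[R]_N) erefl) => _ [A oA <-].
rewrite setTI; apply: sub_gen_smallest.
have /continuousP : continuous (fun x : 'rV[R]_N => x - y)%R.
  by move=> x; apply: (@continuousB _ _ _ id (cst y)) => //;
    exact: cst_continuous.
exact.
Qed.

HB.instance Definition _ y :=
  isMeasurableFun.Build _ _ _ _ (subrV y) (measurable_subrV y).

(* The translated measure mu(. + y): A |-> mu {x | x - y \in A} = mu (A + y). *)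
Definition translate (y : 'rV[R]_N) (mu : probability (borel_rV R N) R) :
    probability (borel_rV R N) R :=
  distribution mu (subrV y).

Definition weak_star_cvg (mu_ : nat -> probability (borel_rV R N) R)
    (mu : probability (borel_rV R N) R) :=
  forall phi : 'rV[R]_N -> R, continuous phi ->
    compact (closure [set x | phi x != 0%R]) ->
    \int[mu_ n]_x (phi x)%:E @[n --> \oo] --> \int[mu]_x (phi x)%:E.

Definition weak_star_limit_point (mu_ : nat -> probability (borel_rV R N) R)
    (mu : probability (borel_rV R N) R) :=
  exists2 s : nat -> nat, {homo s : m n / (m < n)%N} &
    weak_star_cvg (mu_ \o s) mu.

Definition weak_star_precompact
    (mu_ : nat -> probability (borel_rV R N) R) :=
  forall s : nat -> nat, {homo s : m n / (m < n)%N} ->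
    exists mu, weak_star_limit_point (mu_ \o s) mu.

End euclidean_space.
Arguments at_infinity R N : clear implicits.

Definition rV_cons (R : realType) (N : nat)
    (p : measurableTypeR R * borel_rV R N) : borel_rV R N.+1 :=
  (row_mx (const_mx p.1 : 'rV[R]_1) (p.2 : 'rV[R]_N) : 'rV[R]_(1 + N)).

(* Lebesgue measure on the Borel sets of R^N: the N-fold product of the
   one-dimensional one, transported by R * R^N ~ R^(N+1). *)
Fixpoint lebesgue_measure_rV (R : realType) (N : nat) :
    set (borel_rV R N) -> \bar R :=
  match N with
  | 0 => dirac ((0%R : 'rV[R]_0) : borel_rV R 0)
  | N'.+1 =>
    pushforward (@lebesgue_measure R \x lebesgue_measure_rV (N := N'))
      (@rV_cons R N')
  end.
Arguments lebesgue_measure_rV : clear implicits.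

(* Alias of p carrying a proof of sigma-finiteness, to attach the instance. *)
Definition sigma_finite_copy d (T : measurableType d) (R : realType)
  (p : {measure set T -> \bar R}) of sigma_finite [set: T] p :
  set T -> \bar R := p.

HB.instance Definition _ d T R p sp :=
  Measure.copy (@sigma_finite_copy d T R p sp) p.

HB.instance Definition _ d T R p sp :=
  Measure_isSigmaFinite.Build _ _ _ (@sigma_finite_copy d T R p sp) sp.

Section lebesgue_measure_rV.
Local Open Scope ring_scope.
Context {R : realType}.

Let rV_consE N p (i : 'I_N.+1) :
  (rV_cons p : 'rV[R]_N.+1) 0 i =
  if unlift 0 i is Some j then (p.2 : 'rV[R]_N) 0 j else p.1.
Proof.
rewrite /rV_cons; case: unliftP => [j ->|->].
  have -> : lift 0 j = rshift 1 j by exact/val_inj.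
  exact: row_mxEr.
have -> : 0 = lshift N 0 :> 'I_(1 + N) by exact/val_inj.
by rewrite [LHS](@row_mxEl R 1 1 N) mxE.
Qed.

Lemma measurable_coord_rV N (i : 'I_N) :
  measurable_fun [set: borel_rV R N]
    ((fun x : 'rV[R]_N => x 0 i) : borel_rV R N -> R).
Proof.
apply: (measurability _ (RGenOpens.measurableE R)).
move=> _ [_ [a [b ->] <-]]; rewrite setTI; apply: sub_gen_smallest.
move/continuousP: (@coord_continuous R 1 N 0 i); apply.
exact: interval_open.
Qed.

Lemma measurable_rV d (T : measurableType d) N (f : T -> borel_rV R N) :
  (forall i, measurable_fun [set: T] (fun t => (f t : 'rV[R]_N) 0 i)) ->
  measurable_fun [set: T] f.
Proof.
move=> mf; apply: (@measurability _ _ T (borel_rV R N) _ _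
  (@open 'rV[R]_N) erefl) => _ [U oU <-].
pose B (qk : 'rV[rat]_N * nat) : set 'rV[R]_N :=
  ball (map_mx ratr qk.1 : 'rV[R]_N) (qk.2.+1%:R^-1 : R).
have -> : U = \bigcup_(qk in [set qk | B qk `<=` U]) B qk.
  apply/seteqP; split => [x Ux|x [qk /= BU]]; last exact: BU.
  move: oU; rewrite openE => /(_ _ Ux) /nbhs_ballP[e /= e0 xeU].
  have [k ke] : exists k, (k.+1%:R^-1 < e / 2)%R.
    have /ltr_add_invr[k] : (0 < e / 2)%R by rewrite divr_gt0.
    by rewrite add0r => ?; exists k.
  have /choice[q qP] : forall i, exists q : rat,
      ball (x 0 i) (k.+1%:R^-1 : R) (ratr q : R).
    move=> i; have k0 : (0 < (k.+1%:R^-1 : R))%R by rewrite invr_gt0.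
    have [||z [xq [q _ qE]]] := @dense_rat R (ball (x 0 i) (k.+1%:R^-1)).
    - by exists (x 0 i); exact: ballxx.
    - by rewrite ball_itv; exact: interval_open.
    - by exists q; rewrite qE.
  have Bqx : ball (x : 'rV[R]_N) (k.+1%:R^-1 : R)
      (map_mx ratr (\row_i q i) : 'rV[R]_N).
    by split; [rewrite invr_gt0|move=> i j; rewrite (ord1 i) !mxE; exact: qP].
  exists (\row_i q i, k); last exact/ball_sym.
  move=> z Bz; apply: xeU; rewrite (splitr e).
  by apply: (@le_ball _ _ x (k.+1%:R^-1 + k.+1%:R^-1)%R);
    [rewrite lerD// ltW|exact: ball_triangle Bqx Bz].
rewrite setTI preimage_bigcup bigcup_mkcond.
apply: countable_bigcupT_measurable => [|qk]; first exact: countableP.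
case: ifP => _ //.
rewrite [X in measurable X](_ : _ = \bigcap_(i in [set: 'I_N])
    ((fun t => (f t : 'rV[R]_N) 0 i) @^-1`
       ball (ratr (qk.1 0 i) : R) (qk.2.+1%:R^-1 : R))); last first.
  apply/seteqP; split => [t [_ Bt] i _|t Bt] /=.
    by have := Bt 0 i; rewrite mxE.
  split; first by rewrite invr_gt0.
  by move=> i j; rewrite (ord1 i) mxE; exact: Bt.
apply: fin_bigcap_measurable => [|i _]; first exact: finite_finset.
rewrite -[X in measurable X]setTI; apply: mf => //.
by rewrite ball_itv; exact: measurable_itv.
Qed.

Let measurable_rV_cons N : measurable_fun setT (@rV_cons R N).
Proof.
apply: measurable_rV => i.
under eq_fun do rewrite rV_consE.
case: unliftP => [j _|_]; last exact: measurable_fst.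
exact: (measurableT_comp (measurable_coord_rV j) measurable_snd).
Qed.

Let rV_uncons N : borel_rV R N.+1 -> measurableTypeR R * borel_rV R N :=
  fun v => ((v : 'rV[R]_N.+1) 0 0,
            \row_j (v : 'rV[R]_N.+1) 0 (lift 0 j)).

Let rV_consK N : cancel (@rV_cons R N) (@rV_uncons N).
Proof.
move=> [x v]; rewrite /rV_uncons !rV_consE unlift_none /=; congr pair.
by apply/rowP => j; rewrite mxE rV_consE liftK.
Qed.

Let measurable_rV_uncons N : measurable_fun setT (@rV_uncons N).
Proof.
apply/measurable_fun_pairP; split; first exact: measurable_coord_rV.
apply: measurable_rV => i /=.
by under eq_fun do rewrite mxE; exact: measurable_coord_rV.
Qed.

Lemma lebesgue_measure_rV_sigma_finite N :
  exists m : {sigma_finite_measure set (borel_rV R N) -> \bar R},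
    m = lebesgue_measure_rV R N :> (set _ -> \bar R).
Proof.
elim: N => [|N [m mE]].
  by exists (dirac ((0%R : 'rV[R]_0) : borel_rV R 0) :
    {sigma_finite_measure set (borel_rV R 0) -> \bar R}).
pose q : {measure set (borel_rV R N.+1) -> \bar R} :=
  (pushforward (@lebesgue_measure R \x m)%E (@rV_cons R N)).
pose p := q (@measurable_rV_cons N).
have sp : sigma_finite setT p.
  have /sigma_finiteP[F [TF ndF Foo]] := sigma_finiteT (@lebesgue_measure R).
  have /sigma_finiteP[G [TG ndG Goo]] := sigma_finiteT m.
  exists (fun k => @rV_uncons N @^-1` (F k `*` G k)).
    apply/seteqP; split => // v _.
    have [i _ Fi] : (\bigcup_i F i) (rV_uncons v).1 by rewrite -TF.
    have [j _ Gj] : (\bigcup_j G j) (rV_uncons v).2 by rewrite -TG.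
    exists (maxn i j) => //; split.
    - by move: Fi; exact/subsetPset/ndF/leq_maxl.
    - by move: Gj; exact/subsetPset/ndG/leq_maxr.
  move=> k; have [mF Fk] := Foo k; have [mG Gk] := Goo k; split.
    rewrite -[X in measurable X]setTI.
    by apply: measurable_rV_uncons => //; exact: measurableX.
  rewrite /p /q /= /pushforward /=.
  rewrite (_ : _ @^-1` _ = F k `*` G k); last first.
    by apply/funext => x; rewrite /preimage /mkset rV_consK.
  by rewrite product_measure1E// lte_mul_pinfty// ge0_fin_numE.
by exists (sigma_finite_copy sp); rewrite /= -mE.
Qed.

Let leb0 N : lebesgue_measure_rV R N set0 = 0%E.
Proof.
by have [m <-] := lebesgue_measure_rV_sigma_finite N; exact: measure0.
Qed.

Let leb_ge0 N A : (0 <= lebesgue_measure_rV R N A)%E.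
Proof.
by have [m <-] := lebesgue_measure_rV_sigma_finite N; exact: measure_ge0.
Qed.

Let leb_sigma_additive N : semi_sigma_additive (lebesgue_measure_rV R N).
Proof.
have [m <-] := lebesgue_measure_rV_sigma_finite N.
exact: measure_semi_sigma_additive.
Qed.

HB.instance Definition _ N := isMeasure.Build _ _ _ (lebesgue_measure_rV R N)
  (leb0 N) (@leb_ge0 N) (@leb_sigma_additive N).

Let leb_sigma_finite N : sigma_finite setT (lebesgue_measure_rV R N).
Proof.
by have [m <-] := lebesgue_measure_rV_sigma_finite N; exact: sigma_finiteT.
Qed.

HB.instance Definition _ N := Measure_isSigmaFinite.Build _ _ _
  (lebesgue_measure_rV R N) (@leb_sigma_finite N).

Lemma lebesgue_measure_rV_box N (a b : 'rV[R]_N) :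
  (forall i, a 0 i <= b 0 i) ->
  lebesgue_measure_rV R N
    [set x | forall i, a 0 i <= (x : 'rV[R]_N) 0 i <= b 0 i] =
  (\prod_(i < N) (b 0 i - a 0 i))%:E.
Proof.
elim: N a b => [|N IH] a b ab.
  by rewrite big_ord0 /= diracE mem_set// => -[].
rewrite big_ord_recl EFinM /=.
pose a' : 'rV[R]_N := \row_i a 0 (lift 0 i).
pose b' : 'rV[R]_N := \row_i b 0 (lift 0 i).
rewrite (eq_bigr (fun i => b' 0 i - a' 0 i)); last by move=> i _; rewrite !mxE.
rewrite -IH; last by move=> i; rewrite !mxE.
pose B : set (borel_rV R N) :=
  [set x | forall i, a' 0 i <= (x : 'rV[R]_N) 0 i <= b' 0 i].
pose I := `[a 0 0, b 0 0]%classic.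
transitivity (lebesgue_measure I * lebesgue_measure_rV R N B)%E; last first.
  rewrite /I lebesgue_measure_itv/= lte_fin; case: ifPn => //.
  rewrite -leNgt => ba; congr (_ * _)%E.
  by rewrite (_ : b 0 0 = a 0 0) ?subrr//; apply/eqP; rewrite eq_le ba ab.
have mI : measurable (I : set (measurableTypeR R)) by exact: measurable_itv.
have mB : measurable B.
  rewrite (_ : B = \bigcap_(i in [set: 'I_N])
      ((fun x : 'rV[R]_N => x 0 i) @^-1` `[a' 0 i, b' 0 i]%classic)); last first.
    apply/seteqP; split => [x xab i _|x xab i] /=; first by rewrite in_itv/= xab.
    by have := xab i Logic.I; rewrite /= in_itv.
  apply: fin_bigcap_measurable => [|i _]; first exact: finite_finset.
  by rewrite -[X in measurable X]setTI; exact: measurable_coord_rV.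
rewrite -product_measure1E// /pushforward; congr ((_ \x _)%E _).
apply/seteqP; split => -[x v] /=.
  move=> H; split.
    by rewrite /I/= in_itv/=; have := H 0; rewrite rV_consE unlift_none.
  by move=> i; have := H (lift 0 i); rewrite rV_consE liftK !mxE.
rewrite /I/= in_itv/= => -[H0 H] i.
rewrite rV_consE; case: unliftP => [j ->|-> //].
by have := H j; rewrite !mxE.
Qed.

End lebesgue_measure_rV.

Definition locally_integrable_rV (R : realType) (N : nat)
    (g : 'rV[R]_N -> \bar R) :=
  measurable_fun [set: borel_rV R N] g /\
  forall K : set 'rV[R]_N, compact K ->
    \int[lebesgue_measure_rV R N]_(x in K) `|g x| < +oo.

Section energies.
Context {R : realType} {N : nat}.
Variable g : 'rV[R]_N -> \bar R.

Definition energy (mu : probability (borel_rV R N) R) : \bar R :=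
  \int[mu]_y \int[mu]_x g (x - y)%R.

Definition is_empirical (n : nat) (mu : probability (borel_rV R N) R)
    (x : 'I_n -> 'rV[R]_N) :=
  forall A : set (borel_rV R N), measurable A ->
    mu A = (n%:R^-1)%:E * \sum_(i < n) dirac (x i : borel_rV R N) A.

(* Pairs i <> j of indices, so coinciding points contribute g 0. *)
Definition pair_energy (n : nat) (x : 'I_n -> 'rV[R]_N) : \bar R :=
  ((n%:R ^+ 2)^-1)%:E * \sum_(i < n) \sum_(j < n | j != i) g (x i - x j)%R.

(* The value does not depend on the chosen points, see [discrete_energyE]. *)
Definition discrete_energy (n : nat) (mu : probability (borel_rV R N) R) :
    \bar R :=
  if pselect (exists x : 'I_n -> 'rV[R]_N, is_empirical mu x) is left xP
  then pair_energy (sval (cid xP)) else +oo.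

Lemma is_empirical_perm n mu (x y : 'I_n -> 'rV[R]_N) :
  is_empirical mu x -> is_empirical mu y ->
  exists p : 'S_n, forall i, x i = y (p i).
Proof.
case: n x y => [|n] x y xmu ymu; first by exists 1%g => -[].
have /tuple_permP[p pE] : perm_eq [tuple x i | i < n.+1] [tuple y i | i < n.+1].
  apply/allP => z _ /=; apply/eqP.
  have m1 : measurable ([set z] : set (borel_rV R N)).
    rewrite -[X in measurable X]setCK; apply: measurableC.
    apply: sub_gen_smallest; rewrite openC.
    exact: accessible_closed_set1 (hausdorff_accessible (@norm_hausdorff R _)) z.
  have cnt (u : 'I_n.+1 -> 'rV[R]_N) :
      \sum_(i < n.+1) dirac (u i : borel_rV R N) [set z] =
      (count_mem z [tuple u i | i < n.+1])%:R%:E.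
    under eq_bigr => i _ do rewrite diracE in_set1.
    rewrite sumEFin -natr_sum; congr (_%:R%:E).
    rewrite -sum1_count big_tuple [RHS]big_mkcond; apply: eq_bigr => i _ /=.
    by rewrite tnth_mktuple; case: (_ == _).
  have n0 : (n.+1%:R^-1 != 0 :> R)%R by rewrite invr_eq0 pnatr_eq0.
  have := ymu _ m1; rewrite (xmu _ m1) !cnt -!EFinM => -[] /(mulfI n0)/eqP.
  by rewrite eqr_nat => /eqP.
exists p => i.
by have /(congr1 (fun t => tnth t i)) := val_inj pE; rewrite !tnth_mktuple.
Qed.

Lemma discrete_energyE n mu (x : 'I_n -> 'rV[R]_N) :
  is_empirical mu x -> discrete_energy n mu = pair_energy x.
Proof.
move=> xmu; rewrite /discrete_energy; case: pselect => [xP|]; last by case; exists x.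
have [p pE] := is_empirical_perm (svalP (cid xP)) xmu.
rewrite /pair_energy; congr (_ * _).
rewrite [RHS](reindex_inj (@perm_inj _ p)); apply: eq_bigr => i _.
rewrite [RHS](reindex_inj (@perm_inj _ p)).
by apply: eq_big => [j|j _]; rewrite ?(inj_eq (@perm_inj _ p))// !pE.
Qed.

(* At n = 0 no probability measure is empirical, so this is +oo there. *)
Definition min_discrete_energy (n : nat) : \bar R :=
  ereal_inf (range (discrete_energy n)).

Definition is_energy_minimizer (mu : probability (borel_rV R N) R) :=
  forall nu : probability (borel_rV R N) R, energy mu <= energy nu.

End energies.

(* Main.v *)
(* Upper bound.  Given [mu] of finite energy, the mean of the discrete energy of
   [n] independent points of law [mu] is [(1 - 1/n)] times the energy of [mu];
   good points are picked one at a time by conditional expectations.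

   Concentration.  Cut space into large cubes whose position is chosen among
   finitely many shifts so that few close pairs are separated.  Pairs in distinct
   cubes contribute almost nothing negative, since the kernel is asymptotically
   nonnegative, and a cube containing the fraction [a] of the points contributes
   at least about [l * a ^+ 2].  As [l < 0], an energy close to [l] forces one
   cube to contain almost all points, i.e. tightness up to translations.

   Compactness.  List the points of the [k]-th configuration in an order adapted
   to nested partitions of space and run through the list at constant speed on
   [0, 1].  For a tight sequence a diagonal extraction makes these step functions
   converge almost everywhere; the law of the limit is the weak-star limit, and
   applying Fatou's lemma twice bounds its energy by the limit of the discrete
   energies. *)
Require Import Defs.
From HB Require Import structures.
From mathcomp Require Import all_boot all_order all_algebra perm.
From mathcomp Require Import all_classical all_reals all_analysis.
From mathcomp Require Import measurable_realfun.
From mathcomp Require Import zify ring lra.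

Set Implicit Arguments.
Unset Strict Implicit.
Unset Printing Implicit Defensive.

Import Order.TTheory GRing.Theory Num.Theory.
Import numFieldNormedType.Exports.

Local Open Scope classical_set_scope.
Local Open Scope ring_scope.

(** * Concentration of near-minimizing configurations *)

(** The discrete energy omits the diagonal, whereas [g 0] may be [+oo] and a limit law may have
    atoms, so the double sum is not the double integral of [g] against the empirical measure.
    Realizing all laws on one time interval settles this: what is omitted at stage [k] are the pairs
    of times in a common slot, a set that shrinks to the null diagonal of times whether or not
    points coincide, and pointwise convergence is all that lower semicontinuity asks for.

    The lower bound for a cube needs no separate estimate. The points of a cube are a configuration
    in their own right, so the definition of [l] bounds their energy once they are numerous, and
    cubes with few points cost only a term linear in the number of points.

    Averaging gives [l <= energy g mu] for every [mu], hence [l < 0]. Compactness along indices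
    where the discrete infimum is close to [l] then yields some [mu] with [energy g mu <= l]; only
    when averaging is applied to this minimizer does the whole sequence of infima converge. *)

Lemma ler_coord_norm (R : realType) N (x : 'rV[R]_N) i : `|x 0 i| <= `|x|.
Proof.
rewrite [leRHS]/Num.Def.normr/= mx_normrE.
exact: (@le_bigmax _ _ _ 0 (fun ij : 'I_1 * 'I_N => `|x ij.1 ij.2|) (0, i)).
Qed.

Lemma ler_norm_coord (R : realType) N (x : 'rV[R]_N) e :
  0 <= e -> (forall i, `|x 0 i| <= e) -> `|x| <= e.
Proof.
move=> e0 xe; rewrite /Num.Def.normr/= mx_normrE bigmax_le//= => -[i j] _ /=.
by rewrite (ord1 i).
Qed.

(** A separating shift [j] places some integer [m * M - j] in the half-open interval from [M * a] to
    [M * b], of length less than 1. Two such integers coincide, so two separating shifts are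
    congruent modulo [M], hence equal. *)
Lemma floor_shift_neq (R : realType) (M : nat) (a b : R) :
  (0 < M)%N -> `|a - b| < M%:R^-1 ->
  (#|[pred j : 'I_M | Num.floor (a + j%:R / M%:R)%R
     != Num.floor (b + j%:R / M%:R)%R]| <= 1)%N.
Proof.
move=> M0; wlog ab : a b / a <= b => [hw abM|].
  have [ab|/ltW ba] := leP a b; first exact: hw.
  rewrite (eq_card (B := [pred j : 'I_M | Num.floor (b + j%:R / M%:R)%R
     != Num.floor (a + j%:R / M%:R)%R])).
    by apply: hw => //; rewrite distrC.
  by move=> j; rewrite !inE eq_sym.
have MR : 0 < M%:R :> R by rewrite ltr0n.
rewrite ler0_norm ?subr_le0// opprB => abM.
have {}abM : (b - a) * M%:R < 1 by rewrite -ltr_pdivlMr// div1r.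
have key (j : 'I_M) : Num.floor (a + j%:R / M%:R) != Num.floor (b + j%:R / M%:R) ->
    exists m : int, M%:R * a < m%:~R * M%:R - j%:R <= M%:R * b.
  move=> ne; exists (Num.floor (b + j%:R / M%:R)).
  set m := Num.floor (b + _).
  have fab : Num.floor (a + j%:R / M%:R) <= m by rewrite le_floor// lerD2r.
  have : a + j%:R / M%:R < m%:~R by rewrite -floor_lt_int lt_neqAle ne fab.
  have : m%:~R <= b + j%:R / M%:R by exact: floor_le.
  rewrite -(ler_pM2r MR) -[_ < m%:~R](ltr_pM2r MR) !mulrDl !divfK ?gt_eqF//; lra.
apply/card_le1_eqP => j j'; rewrite !inE => /key[m /andP[am mb]] /key[m' /andP[am' m'b]].
apply/val_inj => /=.
have lt1 : `|(m' - m) * M%:Z - (j'%:Z - j%:Z)| < 1.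
  rewrite -(ltr_int R) intr_norm !(rmorphB, rmorphM) /= ltr_norml.
  apply/andP; split; lra.
have : (m' - m) * M%:Z = j'%:Z - j%:Z by lia.
have := ltn_ord j; have := ltn_ord j'; move: (m' - m) => d jM j'M dM.
have d0 : d = 0 by nia.
by move: dM; rewrite d0; lia.
Qed.

(* Index of the cube of side [L * M] containing [x] in the grid shifted by
   [j * L] along the diagonal.  Averaging over the [M] shifts plays the role of
   a uniformly random shift: nearby points are rarely separated. *)
Definition cell (R : realType) N (L : R) (M j : nat) (x : 'rV[R]_N) : 'rV[int]_N :=
  map_mx (fun t : R => Num.floor (t / (L * M%:R) + j%:R / M%:R)) x.

(** Each coordinate accounts for at most one separating shift: divided by the side [L * M], the
    coordinates differ by less than [1 / M]. *)
Lemma cell_shift_neq (R : realType) N (L : R) (M : nat) (x y : 'rV[R]_N) :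
  (0 < M)%N -> `|x - y| < L ->
  (#|[pred j : 'I_M | cell L M j x != cell L M j y]| <= N)%N.
Proof.
move=> M0 xyL; have L0 : 0 < L by exact: le_lt_trans xyL.
have MR : 0 < M%:R :> R by rewrite ltr0n.
pose B i := [pred j : 'I_M |
  Num.floor (x 0 i / (L * M%:R) + j%:R / M%:R)
  != Num.floor (y 0 i / (L * M%:R) + j%:R / M%:R)].
have B1 i : (#|B i| <= 1)%N.
  apply: floor_shift_neq => //; rewrite -mulrBl normrM.
  have xyi : `|x 0 i - y 0 i| < L.
    by apply: le_lt_trans xyL; have := ler_coord_norm (x - y) i; rewrite !mxE.
  rewrite [X in _ * X]ger0_norm ?invr_ge0 ?mulr_ge0 ?ltW//.
  by rewrite invfM mulrA gtr_pMl ?invr_gt0// ltr_pdivrMr ?mul1r.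
rewrite -sum1_card; apply: (@leq_trans (\sum_(j < M) \sum_(i < N) (j \in B i))%N).
  rewrite big_mkcond; apply: leq_sum => j _; case: ifPn => // jB.
  rewrite lt0n; apply: contraNneq jB => /eqP; rewrite sum_nat_eq0 => /forallP jB.
  apply/eqP/rowP => i; rewrite !mxE.
  by have /= := jB i; rewrite eqb0 inE negbK => /eqP.
rewrite exchange_big /= -[leqRHS]card_ord -sum1_card; apply: leq_sum => i _.
by apply: leq_trans (B1 i); rewrite -sum1_card [leqRHS]big_mkcond.
Qed.

Lemma cell_diam (R : realType) N (L : R) (M j : nat) (x y : 'rV[R]_N) :
  (0 < M)%N -> 0 < L -> cell L M j x = cell L M j y -> `|x - y| <= L * M%:R.
Proof.
move=> M0 L0 /rowP xy; have LM : 0 < L * M%:R by rewrite mulr_gt0 ?ltr0n.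
apply: ler_norm_coord => [|i]; first exact: ltW.
have := xy i; rewrite !mxE.
set a := x 0 i / _ + _; set b := y 0 i / _ + _ => ab.
have -> : x 0 i - y 0 i = (a - b) * (L * M%:R).
  by rewrite /a /b; field; rewrite !gt_eqF ?ltr0n.
rewrite normrM (gtr0_norm LM); apply: ler_piMl; [exact: ltW|rewrite ler_norml].
have := floor_itv a; have := floor_itv b; rewrite ab !intrD.
by move=> /andP[? ?] /andP[? ?]; apply/andP; split; lra.
Qed.

(** Double counting: each close pair is separated by at most [N] of the [M] shifts, so some shift
    separates no more pairs than the average. *)
Lemma exists_good_shift (R : realType) N (L : R) (M n : nat) (x : 'I_n -> 'rV[R]_N) :
  (0 < M)%N -> exists j : 'I_M,
    (M * #|[pred p : 'I_n * 'I_n | (`|x p.1 - x p.2| < L)%R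
      && (cell L M j (x p.1) != cell L M j (x p.2))]| <= N * n ^ 2)%N.
Proof.
move=> M0; apply/existsP; apply: contraT; rewrite negb_exists => /forallP H.
pose bad (j : 'I_M) (p : 'I_n * 'I_n) := (`|x p.1 - x p.2| < L)%R
      && (cell L M j (x p.1) != cell L M j (x p.2)).
have : (\sum_(j < M) M * #|bad j| <= M * (N * n ^ 2))%N.
  rewrite -big_distrr leq_mul2l; apply/orP; right.
  under eq_bigr do rewrite -sum1_card big_mkcond.
  rewrite exchange_big /= mulnC.
  rewrite (_ : n ^ 2 = #|{: 'I_n * 'I_n}|)%N; last by rewrite card_prod card_ord.
  rewrite -sum_nat_const; apply: leq_sum => p _.
  have [pL|pL] := ltP `|x p.1 - x p.2| L.
    apply: leq_trans (cell_shift_neq M0 pL); rewrite -sum1_card [leqRHS]big_mkcond.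
    by apply: leq_sum => j _; case: ifPn => // /andP[_ ne]; rewrite ifT.
  by rewrite big1// => j _; case: ifPn => // /andP[]; rewrite ltNge pL.
rewrite leqNgt => /negP; case.
rewrite -[X in (X * _ < _)%N]card_ord -sum_nat_const.
have mono j : (N * n ^ 2 < M * #|bad j|)%N by rewrite ltnNge; exact: H.
rewrite (bigD1 (Ordinal M0))//= [ltnRHS](bigD1 (Ordinal M0))//=.
rewrite -addSn leq_add ?mono// leq_sum// => j _.
exact/ltnW/mono.
Qed.

(** Summing over [i] the size of the class of [i] gives the sum of the squared class sizes, which is
    what the hypothesis produces when added up over the classes of [f]. *)
Lemma cluster_sum (R : realType) n (T : eqType) (f : 'I_n -> T)
    (G : 'I_n -> 'I_n -> R) (lam kap : R) :
  (forall A : {set 'I_n}, lam * #|A|%:R ^+ 2 - kap * #|A|%:R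
     <= \sum_(i in A) \sum_(j in A | j != i) G i j) ->
  lam * (\sum_(i < n) #|[set j | f j == f i]%SET|%:R) - kap * n%:R
    <= \sum_(i < n) \sum_(j < n | (f j == f i) && (j != i)) G i j.
Proof.
move=> H; pose p i := [set j | f j == f i]%SET.
have pE i j : (p j == p i) = (j \in p i).
  apply/eqP/idP => [<-|]; first by rewrite inE.
  by rewrite inE => /eqP fji; apply/setP => k; rewrite !inE fji.
have -> : lam * (\sum_(i < n) #|p i|%:R) - kap * n%:R =
    \sum_(i < n) (lam * #|p i|%:R - kap).
  by rewrite sumrB -mulr_sumr sumr_const card_ord mulr_natr.
rewrite (partition_big p xpredT)//= [leRHS](partition_big p xpredT)//=.
apply: ler_sum => A _.
have [/existsP[i0 /eqP <-]|/existsPn noA] := boolP [exists i, p i == A]; last first.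
  by rewrite big_pred0 ?big_pred0// => i; exact/negbTE.
rewrite (eq_bigl (mem (p i0))); last by move=> i; rewrite pE.
rewrite (eq_bigr (fun=> lam * #|p i0|%:R - kap)); last first.
  by move=> i; rewrite /= -pE => /eqP ->.
rewrite sumr_const.
rewrite (eq_bigl (mem (p i0))); last by move=> i; rewrite pE.
apply: le_trans (le_trans (H (p i0)) _).
  by rewrite -[leLHS]mulr_natr mulrBl expr2 mulrA.
rewrite le_eqVlt; apply/orP; left; apply/eqP; apply: eq_bigr => i.
rewrite /= -pE => /eqP pi; apply: eq_bigl => j.
by rewrite -pi inE.
Qed.

(** Pairs are of three kinds. Those in a common cube are handled by [cluster_sum], where [spread]
    bounds each cube population by [(1 - eta) * n] and [lam <= 0] gives the direction. Separated
    distant pairs cost [eps] each, and a good shift leaves at most [N * n ^ 2 / M] separated close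
    pairs, costing [c] each. *)
Lemma spread_energy_ge (R : realType) N n (x : 'I_n -> 'rV[R]_N)
    (G : 'I_n -> 'I_n -> R) (L c eps lam kap eta : R) (M : nat) :
  (0 < M)%N -> 0 < L -> 0 <= c -> 0 <= eps -> lam <= 0 ->
  (forall i j, i != j -> - c <= G i j) ->
  (forall i j, i != j -> L <= `|x i - x j| -> - eps <= G i j) ->
  (forall A : {set 'I_n}, lam * #|A|%:R ^+ 2 - kap * #|A|%:R
     <= \sum_(i in A) \sum_(j in A | j != i) G i j) ->
  (forall y, #|[set i | (`|x i - y| <= L * M%:R)%R]%SET|%:R <= (1 - eta) * n%:R) ->
  lam * (1 - eta) * n%:R ^+ 2 - kap * n%:R - eps * n%:R ^+ 2
    - c * N%:R * n%:R ^+ 2 / M%:R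
    <= \sum_(i < n) \sum_(j < n | j != i) G i j.
Proof.
move=> M0 L0 c0 eps0 lam0 Gc Geps GA spread.
have MR : 0 < M%:R :> R by rewrite ltr0n.
have [s Hs] := exists_good_shift L x M0.
set bad := [pred p : 'I_n * 'I_n | _] in Hs.
pose f i := cell L M s (x i).
have := @cluster_sum R n _ f G lam kap GA.
have le1 : lam * ((1 - eta) * n%:R ^+ 2) <=
    lam * (\sum_(i < n) #|[set j | f j == f i]%SET|%:R).
  rewrite ler_wnM2l// (le_trans (y := \sum_(i < n) (1 - eta) * n%:R))//.
    apply: ler_sum => i _; apply: le_trans (spread (x i)); rewrite ler_nat.
    apply: subset_leq_card; apply/fintype.subsetP => j; rewrite !inE => /eqP.
    exact: cell_diam.
  by rewrite sumr_const card_ord -[leLHS]mulr_natr expr2 mulrA.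
have le2 : - (eps * n%:R ^+ 2) - c * #|bad|%:R <=
    \sum_(i < n) \sum_(j < n | (f j != f i) && (j != i)) G i j.
  have -> : - (eps * n%:R ^+ 2) - c * #|bad|%:R =
      \sum_(i < n) \sum_(j < n) (- eps - c * (bad (i, j))%:R).
    rewrite pair_big /= sumrB sumr_const card_prod card_ord.
    rewrite -mulr_sumr -natr_sum mulNrn -[eps *+ _]mulr_natr natrM expr2.
    congr (_ - c * _%:R); rewrite -sum1_card big_mkcond /=.
    by apply: eq_bigr => -[i j] _; case: ifP; rewrite inE /= => ->.
  apply: ler_sum => i _; rewrite [leRHS]big_mkcond /=; apply: ler_sum => j _.
  case: ifPn => [/andP[fji ji]|_]; last first.
    by rewrite subr_le0 (le_trans (y := 0)) ?oppr_le0// mulr_ge0.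
  rewrite /= eq_sym fji andbT.
  have [_|Lx] := ltP; first by rewrite mulr1; have := Gc i j; rewrite eq_sym ji => /(_ isT); lra.
  by rewrite mulr0 subr0; apply: Geps; rewrite // eq_sym.
have le3 : c * #|bad|%:R <= c * N%:R * n%:R ^+ 2 / M%:R.
  have : (M * #|bad|)%:R <= (N * n ^ 2)%:R :> R by rewrite ler_nat.
  rewrite !natrM mulrC -ler_pdivlMr// => /(ler_wpM2l c0).
  by rewrite expr2 !mulrA.
have -> : \sum_(i < n) \sum_(j < n | j != i) G i j =
   \sum_(i < n) \sum_(j < n | (f j == f i) && (j != i)) G i j +
   \sum_(i < n) \sum_(j < n | (f j != f i) && (j != i)) G i j.
  rewrite -big_split /=; apply: eq_bigr => i _.
  by rewrite (bigID (fun j => f j == f i)) /=; congr (_ + _); apply: eq_bigl => j; rewrite andbC.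
move: le1 le2 le3; rewrite !mulrA; lra.
Qed.

Lemma pair_energy_real (R : realType) N (g : 'rV[R]_N -> \bar R) (c : R) n
    (x : 'I_n -> 'rV[R]_N) :
  (forall z, (c%:E <= g z)%E) -> (0 < n)%N -> (pair_energy g x < +oo)%E ->
  exists2 G : 'I_n -> 'I_n -> R,
    forall i j, j != i -> g (x i - x j) = (G i j)%:E &
    pair_energy g x = ((n%:R ^+ 2)^-1 * \sum_i \sum_(j | j != i) G i j)%:E.
Proof.
move=> cg n0; have n2 : 0 < (n%:R ^+ 2)^-1 :> R by rewrite invr_gt0 exprn_gt0 ?ltr0n.
rewrite /pair_energy => xoo.
have gNy z : g z != -oo%E by rewrite gt_eqF// (lt_le_trans _ (cg z)) ?ltNyr.
have gfin i j : j != i -> g (x i - x j) \is a fin_num.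
  move=> ji; rewrite fin_numE gNy; apply/eqP => gy.
  move: xoo; rewrite (_ : (\sum_(i < n) _)%E = +oo%E) ?gt0_muley ?lte_fin ?ltxx//.
  apply/eqP; rewrite esum_eqy => [|k _]; last first.
    by rewrite esum_eqNy negb_exists; apply/forallP => k'; rewrite negb_and gNy orbT.
  apply/existsP; exists i; rewrite andTb esum_eqy//.
  by apply/existsP; exists j; rewrite gy eqxx andbT; exact: ji.
exists (fun i j => fine (g (x i - x j))) => [i j ji|]; first by rewrite fineK ?gfin.
rewrite EFinM; congr (_ * _)%E; rewrite -sumEFin; apply: eq_bigr => i _.
by rewrite -sumEFin; apply: eq_bigr => j ji; rewrite fineK ?gfin.
Qed.

Lemma pair_energy_sub (R : realType) N (g : 'rV[R]_N -> \bar R) n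
    (x : 'I_n -> 'rV[R]_N) (G : 'I_n -> 'I_n -> R) (A : {set 'I_n}) :
  (forall i j, j != i -> g (x i - x j) = (G i j)%:E) ->
  pair_energy g (fun i : 'I_#|A| => x (enum_val i)) =
  ((#|A|%:R ^+ 2)^-1 * \sum_(i in A) \sum_(j in A | j != i) G i j)%:E.
Proof.
move=> gG; rewrite /pair_energy EFinM; congr (_ * _)%E.
rewrite -sumEFin [RHS]big_enum_val; apply: eq_bigr => i _.
rewrite -sumEFin [RHS]big_enum_val_cond; apply: eq_big => j.
  by rewrite (inj_eq enum_val_inj).
by move=> ji; rewrite gG// (inj_eq enum_val_inj).
Qed.

(* If the cubes carry the fractions [a_i] of the points, the energy is at least
   about [l * \sum_i a_i ^+ 2 >= l * \max_i a_i]; as [l < 0], an energy close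
   to [l] forces some [a_i] to be close to 1. *)
Lemma concentration (R : realType) N (g : 'rV[R]_N -> \bar R) (c l : R) :
  (forall x, (c%:E <= g x)%E) -> (0 <= limf_einf g (at_infinity R N))%E -> l < 0 ->
  (forall d : R, 0 < d -> exists K : nat, forall k (x : 'I_k -> 'rV[R]_N), (K <= k)%N ->
    ((l - d)%:E <= pair_energy g x)%E) ->
  forall eta : R, 0 < eta -> exists2 d : R, 0 < d &
  exists (S : R) (n0 : nat), forall n (x : 'I_n -> 'rV[R]_N),
    (n0 <= n)%N -> (pair_energy g x <= (l + d)%:E)%E ->
    exists y, (1 - eta) * n%:R < #|[set i | (`|x i - y| <= S)%R]%SET|%:R.
Proof.
move=> cg ginfty l0 lpe eta eta0.
wlog c0 : c cg / c <= 0.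
  move=> /(_ (Num.min c 0)); apply; last by rewrite ge_min lexx orbT.
  by move=> x; apply: le_trans (cg x); rewrite lee_fin ge_min lexx.
(* If no ball holds the fraction [1 - eta], the energy exceeds [l] by about [- l * eta = 8 * d]. The
   errors collected below amount to [5 * d], whence the contradiction. *)
pose d := - l * eta / 8%:R.
have d0 : 0 < d by rewrite /d divr_gt0// mulr_gt0// oppr_gt0.
have [L L0 gL] : exists2 L, 0 < L & forall z, L <= `|z| -> ((- d)%:E <= g z)%E.
  have : ((- d)%:E < limf_einf g (at_infinity R N))%E.
    by apply: lt_le_trans ginfty; rewrite lte_fin oppr_lt0.
  rewrite limf_einfE => /ereal_sup_gt[_ [A [r _ rA] <-]] dA.
  exists (`|r| + 1) => [|z rz]; first by rewrite ltr_pwDr.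
  apply/ltW/(lt_le_trans dA); apply: ereal_inf_lbound; exists z => //.
  by apply: rA => /=; apply: lt_le_trans rz; rewrite ltr_pwDr// ler_norm.
have [K lK] := lpe _ d0.
pose M := (Num.truncn (- c * N%:R / d)).+1.
have M0 : (0 < M)%N by [].
have MR : 0 < M%:R :> R by rewrite ltr0n.
have cM : - c * N%:R / M%:R <= d.
  by rewrite ler_pdivrMr// [d * _]mulrC -ler_pdivrMr// ltW// truncnS_gt.
(* A cube with fewer than [K] points is out of reach of [lK]. There the pointwise bound [c] is used:
   each point has fewer than [K] partners, which costs at most [kap] per point. *)
pose kap := - c * K%:R.
have kap0 : 0 <= kap by rewrite mulr_ge0// oppr_ge0.
exists d => //; exists (L * M%:R), (Num.truncn (kap / d)).+1 => n x n0 xl.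
have nR : 0 < n%:R :> R by rewrite ltr0n; case: n n0 {x xl}.
have kapn : kap <= d * n%:R.
  rewrite mulrC -ler_pdivrMr//; apply: (le_trans (ltW (truncnS_gt _))).
  by rewrite ler_nat.
have nN : (0 < n)%N by rewrite -(ltr0n R).
have xoo : (pair_energy g x < +oo)%E by exact: (le_lt_trans xl (ltry _)).
have [G gG xG] := pair_energy_real cg nN xoo.
apply: contrapT => /forallNP spread.
move: xl; rewrite xG lee_fin mulrC ler_pdivrMr ?exprn_gt0// => xl.
have main : (l - d) * (1 - eta) * n%:R ^+ 2 - kap * n%:R - d * n%:R ^+ 2 -
     - c * N%:R * n%:R ^+ 2 / M%:R <= (l + d) * n%:R ^+ 2.
  apply: le_trans xl; apply: (spread_energy_ge (x := x)) M0 L0 _ _ _ _ _ _ _.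
  - by rewrite oppr_ge0.
  - exact: ltW.
  - by rewrite subr_le0 (le_trans (ltW l0))// ltW.
  - by move=> i j ij; rewrite opprK -lee_fin -gG 1?eq_sym ?ij //; exact: cg.
  - move=> i j ij Lij; rewrite -lee_fin -gG 1?eq_sym ?ij //; exact: gL.
  - move=> A.
    have [AK|AK] := leqP K #|A|.
      have [->|A0] := eqVneq A finset.set0.
        by rewrite cards0 big_set0 expr0n /= !mulr0 subr0.
      have AR : 0 < #|A|%:R :> R by rewrite ltr0n card_gt0.
      have := lK _ (fun i : 'I_#|A| => x (enum_val i)) AK.
      rewrite (pair_energy_sub A gG) lee_fin mulrC ler_pdivlMr ?exprn_gt0//.
      by move=> h; apply: le_trans h; rewrite gerBl mulr_ge0.
    rewrite (le_trans (y := \sum_(i in A) \sum_(j in A | j != i) c))//; last first.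
      apply: ler_sum => i _; apply: ler_sum => j /andP[_ ij].
      by rewrite -lee_fin -gG.
    rewrite (le_trans (y := \sum_(i in A) \sum_(j in A) c))//; last first.
      apply: ler_sum => i _; rewrite [leLHS](bigID (fun j => j != i)) /= gerDl.
      by apply: sumr_le0.
    rewrite !sumr_const -[leRHS]mulr_natr -[c *+ _]mulr_natr.
    have AKR : #|A|%:R <= K%:R :> R by rewrite ler_nat ltnW.
    have A0 : 0 <= #|A|%:R :> R by [].
    have h1 : c * (K%:R * #|A|%:R) <= c * (#|A|%:R * #|A|%:R).
      by apply: ler_wnM2l => //; exact: ler_wpM2r.
    have h2 : (l - d) * #|A|%:R ^+ 2 <= 0.
      by rewrite mulr_le0_ge0 ?sqr_ge0// subr_le0 (le_trans (ltW l0))// ltW.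
    by rewrite /kap; move: h1 h2; rewrite !mulrA; lra.
  - by move=> y; rewrite leNgt; apply/negP; exact: spread.
have n2 : 0 < n%:R ^+ 2 :> R by rewrite exprn_gt0.
have kn : kap * n%:R <= d * n%:R ^+ 2 by rewrite expr2 mulrA ler_pM2r.
have cn : - c * N%:R * n%:R ^+ 2 / M%:R <= d * n%:R ^+ 2.
  by rewrite mulrAC ler_pM2r.
have : (l - d) * (1 - eta) * n%:R ^+ 2 - 3 * d * n%:R ^+ 2 <= (l + d) * n%:R ^+ 2 by lra.
rewrite -mulrBl ler_pM2r//.
have -> : l = - (8 * d / eta) by rewrite /d; field; rewrite gt_eqF.
have : 0 < d * eta by rewrite mulr_gt0.
have -> : (- (8 * d / eta) - d) * (1 - eta) = - (8 * d / eta) - d + 8 * d + d * eta.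
  by field; rewrite gt_eqF.
lra.
Qed.

(** * Upper bound by averaging *)

Lemma integral_cst_probability d (T : measurableType d) (R : realType)
  (P : probability T R) (r : \bar R) : (\int[P]_x r = r)%E.
Proof.
by transitivity (r * P setT)%E; [exact: integral_cst|rewrite probability_setT mule1].
Qed.

(* [f] need not be integrable: its integral may be [+oo]. *)
Lemma integral_addEFin d (T : measurableType d) (R : realType)
    (P : probability T R) (f : T -> \bar R) (b : R) :
  measurable_fun setT f -> (forall x, ((- b)%:E <= f x)%E) -> 0 <= b ->
  (\int[P]_x (f x + b%:E) = \int[P]_x f x + b%:E)%E.
Proof.
move=> mf fb b0.
have fb0 x : (0 <= f x + b%:E)%E.
  by have := fb x; rewrite EFinN -sub0e leeBlDr.
have mp : measurable_fun setT f^\+%E by exact: measurable_funepos.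
have mn : measurable_fun setT f^\-%E by exact: measurable_funeneg.
have mfb : measurable_fun setT (fun x => f x + b%:E)%E by exact: emeasurable_funD.
have fnb x : (f^\- x <= b%:E)%E.
  by rewrite funenegE ge_max lee_fin b0 andbT leeNl -EFinN.
have n0 : (0 <= \int[P]_x f^\- x)%E by exact: integral_ge0.
have nfin : (\int[P]_x f^\- x)%E \is a fin_num.
  rewrite ge0_fin_numE//; apply: (@le_lt_trans _ _ b%:E); last exact: ltry.
  rewrite -[leRHS](integral_cst_probability P); apply: ge0_le_integral => //.
(* Adding the negative part, whose integral is finite, leaves only nonnegative integrands, for which
   additivity holds even at [+oo]. *)
have key : (\int[P]_x (f x + b%:E) + \int[P]_x f^\- x = \int[P]_x f^\+ x + b%:E)%E.
  rewrite -[b%:E in RHS](integral_cst_probability P) -!ge0_integralD//; last first.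
  apply: eq_integral => x _; rewrite funeposE funenegE.
  move: (fb x); case: (f x) => [r| |] // _; last by rewrite maxye maxNye adde0.
  rewrite -EFinN -!EFin_max -!EFinD; congr EFin.
  by have [r0|r0] := leP 0 r; [rewrite max_r ?oppr_le0//|rewrite max_l ?oppr_ge0 ?ltW//]; ring.
by rewrite [X in _ = X + _]integralE addeAC -key addeK.
Qed.

Section averaging.
Local Open Scope ereal_scope.
Context {R : realType} {N : nat}.
Implicit Types (mu : probability (borel_rV R N) R) (h : 'rV[R]_N -> \bar R).

Lemma measurable_rV_sub : measurable_fun [set: borel_rV R N * borel_rV R N]
  (fun p => ((p.1 : 'rV[R]_N) - (p.2 : 'rV[R]_N))%R : borel_rV R N).
Proof.
apply: measurable_rV => i.
rewrite (_ : (fun _ => _) = fun p : borel_rV R N * borel_rV R N =>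
  ((p.1 : 'rV[R]_N) 0 i - (p.2 : 'rV[R]_N) 0 i)%R).
  apply: measurable_funB.
    exact: (measurableT_comp (measurable_coord_rV i) measurable_fst).
  exact: (measurableT_comp (measurable_coord_rV i) measurable_snd).
by apply/funext => p; rewrite !mxE.
Qed.

Lemma measurable_shift h (y : 'rV[R]_N) : measurable_fun [set: borel_rV R N] h ->
  measurable_fun [set: borel_rV R N] (fun x : 'rV[R]_N => h (x - y)%R).
Proof. by move=> mh; exact: (measurableT_comp mh (measurable_subrV y)). Qed.

Definition potential mu h (y : 'rV[R]_N) := \int[mu]_x h (x - y)%R.

Lemma measurable_potential mu h : measurable_fun [set: borel_rV R N] h ->
  (forall z, 0 <= h z) -> measurable_fun [set: borel_rV R N] (potential mu h).
Proof.
move=> mh h0.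
exact: (@measurable_fun_fubini_tonelli_G _ _ _ _ _ mu
  (fun p : borel_rV R N * borel_rV R N =>
     h ((p.1 : 'rV[R]_N) - (p.2 : 'rV[R]_N))%R)
  (measurableT_comp mh measurable_rV_sub) (fun p => h0 _)).
Qed.

Lemma addEFin_ge0 (u : \bar R) (b : R) : (- b)%:E <= u -> 0 <= u + b%:E.
Proof. by rewrite EFinN -sub0e leeBlDr. Qed.

(** This reduces the work to the nonnegative kernel [g + b], for which Tonelli's theorem and Fatou's
    lemma need no integrability. *)
Lemma energy_addEFin mu (g : 'rV[R]_N -> \bar R) (b : R) :
  measurable_fun [set: borel_rV R N] g -> (forall z, (- b)%:E <= g z) -> (0 <= b)%R ->
  energy (fun z => g z + b%:E) mu = energy g mu + b%:E.
Proof.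
move=> mg gb b0; pose h z := g z + b%:E.
have h0 z : 0 <= h z by exact: addEFin_ge0.
have mh : measurable_fun [set: borel_rV R N] h by exact: emeasurable_funD.
have Uh y : potential mu h y = potential mu g y + b%:E.
  by apply: integral_addEFin => //; exact: measurable_shift.
have potb y : (- b)%:E <= potential mu g y.
  rewrite EFinN -sub0e leeBlDr// -Uh; exact: integral_ge0.
have mpot : measurable_fun [set: borel_rV R N] (potential mu g).
  have -> : potential mu g = fun y => potential mu h y - b%:E.
    by apply/funext => y; rewrite Uh addeK.
  by apply: emeasurable_funB => //; exact: measurable_potential.
rewrite -(integral_addEFin mu mpot potb b0).
by apply: eq_integral => y _; rewrite -Uh.
Qed.

(** The slack 1 lets the negation integrate to a strict contradiction when the mean is finite, with
    no discussion of almost everywhere equality. *)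
Lemma exists_le_mean mu (f : 'rV[R]_N -> \bar R) :
  measurable_fun [set: borel_rV R N] f -> (forall z, 0 <= f z) ->
  exists z, f z <= \int[mu]_x f x + 1.
Proof.
move=> mf f0; apply: contrapT => /forallNP H.
have fH z : \int[mu]_x f x + 1 <= f z by rewrite ltW// ltNge; apply/negP; exact: H.
have I0 : 0 <= \int[mu]_x f x by exact: integral_ge0.
have := fH 0%R; have [Ioo _|Ioo _] := eqVneq (\int[mu]_x f x) +oo.
  by apply: (H 0%R); rewrite Ioo leey.
have Ifin : \int[mu]_x f x \is a fin_num by rewrite ge0_fin_numE// ltey.
have : \int[mu]_x (\int[mu]_x f x + 1) <= \int[mu]_x f x.
  by apply: ge0_le_integral => //= z _; rewrite adde_ge0.
rewrite integral_cst_probability leNgt.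
by rewrite lteDl// lte_fin ltr01.
Qed.

(* The left-hand side is the conditional expectation of the pair sum of [n]
   independent points of law [mu] given the first [k] of them.  Each new point
   is chosen so as not to exceed the mean by more than 1; this slack is
   negligible after division by [n ^+ 2]. *)
Lemma greedy_points mu h n k : measurable_fun [set: borel_rV R N] h ->
  (forall z, 0 <= h z) -> (k <= n)%N ->
  exists x : nat -> 'rV[R]_N,
    \sum_(i < k) \sum_(j < i) h (x i - x j)%R
    + (n - k)%:R%:E * (\sum_(i < k) potential mu h (x i))
    + 'C(n - k, 2)%:R%:E * energy h mu
    <= 'C(n, 2)%:R%:E * energy h mu + k%:R%:E.
Proof.
move=> mh h0; have mU := measurable_potential mu mh h0.
have U0 z : 0 <= potential mu h z by exact: integral_ge0.
have E0 : 0 <= energy h mu by apply: integral_ge0 => y _; exact: U0.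
elim: k => [_|k IH kn].
  by exists (fun=> 0%R); rewrite !big_ord0 mule0 subn0 !add0e !adde0.
have [x xk] := IH (ltnW kn).
pose r := (n - k.+1)%N; have nk : (n - k = r.+1)%N by rewrite /r subnSK.
pose A := \sum_(i < k) \sum_(j < i) h (x i - x j)%R
  + r%:R%:E * (\sum_(i < k) potential mu h (x i)) + 'C(r, 2)%:R%:E * energy h mu.
(* [f z] is the conditional expectation once the next point is placed at [z]: this point meets the
   [k] earlier ones and, through its potential, the [r] points still to come. *)
pose f z := A + (\sum_(i < k) h (z - x i)%R + r%:R%:E * potential mu h z).
have SU0 : 0 <= \sum_(i < k) potential mu h (x i) by exact: sume_ge0.
have A0 : 0 <= A.
  apply: adde_ge0; last by rewrite mule_ge0// lee_fin.
  apply: adde_ge0; last by rewrite mule_ge0// lee_fin.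
  by apply: sume_ge0 => i _; exact: sume_ge0.
have mS : measurable_fun [set: borel_rV R N] (fun z => \sum_(i < k) h (z - x i)%R).
  by apply: emeasurable_sum => i; exact: measurable_shift.
have S0 z : 0 <= \sum_(i < k) h (z - x i)%R by exact: sume_ge0.
have mrU : measurable_fun [set: borel_rV R N] (fun z => r%:R%:E * potential mu h z).
  exact: measurable_funeM.
have rU0 z : 0 <= r%:R%:E * potential mu h z by rewrite mule_ge0 ?lee_fin.
have f0 z : 0 <= f z by rewrite adde_ge0// adde_ge0.
have mf : measurable_fun [set: borel_rV R N] f.
  by apply: emeasurable_funD => //; exact: emeasurable_funD.
have If : \int[mu]_z f z = A + (\sum_(i < k) potential mu h (x i) + r%:R%:E * energy h mu).
  rewrite /f ge0_integralD//; last 2 first.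
    by move=> z _; rewrite adde_ge0.
    exact: emeasurable_funD.
  rewrite integral_cst_probability ge0_integralD//.
  rewrite ge0_integral_sum//; last by move=> i; exact: measurable_shift.
  by rewrite ge0_integralZl_EFin.
have [z fz] := exists_le_mean mu mf f0.
pose x' i := if i == k then z else x i; exists x'.
have x'k : x' k = z by rewrite /x' eqxx.
have x'E i : (i < k)%N -> x' i = x i by move=> ik; rewrite /x' ltn_eqF.
have -> : \sum_(i < k.+1) \sum_(j < i) h (x' i - x' j)%R =
    \sum_(i < k) \sum_(j < i) h (x i - x j)%R + \sum_(i < k) h (z - x i)%R.
  rewrite big_ord_recr /= x'k; congr (_ + _); apply: eq_bigr => i _; last by rewrite x'E.
  by apply: eq_bigr => j _; rewrite !x'E// (ltn_trans (ltn_ord j)).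
have -> : \sum_(i < k.+1) potential mu h (x' i) =
    \sum_(i < k) potential mu h (x i) + potential mu h z.
  by rewrite big_ord_recr /= x'k; congr (_ + _); apply: eq_bigr => i _; rewrite x'E.
rewrite -/r; apply: (@le_trans _ _ (f z)).
  rewrite le_eqVlt; apply/orP; left; apply/eqP.
  rewrite /f /A ge0_muleDr//.
  by rewrite [in LHS]addeACA [LHS]addeAC.
apply: le_trans fz _; rewrite If -[k.+1]addn1 natrD EFinD [leRHS]addeA; apply: leeD2r.
(* Pascal's rule splits the pairs among the [r.+1] unplaced points into those avoiding the next
   point and the [r] pairs containing it, so the mean of [f] is the previous left-hand side. *)
apply: le_trans xk; rewrite nk /A binS bin1 -[r.+1]addn1 !natrD !EFinD.
rewrite !ge0_muleDl ?lee_fin// mul1e [leLHS]addeACA -[X in X + _ <= _]addeA.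
exact: lexx.
Qed.

Lemma sum_offdiag n (a : nat -> nat -> \bar R) : (forall i j, a i j = a j i) ->
  \sum_(i < n) \sum_(j < n | j != i) a i j =
  \sum_(i < n) \sum_(j < i) a i j + \sum_(i < n) \sum_(j < i) a i j.
Proof.
move=> asym; elim: n => [|n IH]; first by rewrite !big_ord0 adde0.
rewrite !big_ord_recr /=.
have -> : \sum_(j < n.+1 | j != ord_max) a n j = \sum_(j < n) a n j.
  rewrite big_mkcond big_ord_recr /= eqxx adde0; apply: eq_bigr => j _.
  by rewrite -val_eqE /= ltn_eqF.
have -> : \sum_(i < n) \sum_(j < n.+1 | j != widen_ord (leqnSn n) i) a i j =
    \sum_(i < n) \sum_(j < n | j != i) a i j + \sum_(j < n) a n j.
  rewrite -big_split /=; apply: eq_bigr => i _.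
  rewrite big_mkcond big_ord_recr /= -val_eqE /= gtn_eqF// asym; congr (_ + _).
  by rewrite [RHS]big_mkcond.
by rewrite IH -addeA addeACA.
Qed.

Lemma natrB_pred n : (0 < n)%N -> (n%:R - 1 = n.-1%:R :> R)%R.
Proof. by move=> n0; rewrite -[in LHS](prednK n0) -[n.-1.+1]addn1 natrD addrK. Qed.

Lemma sum_pair_addEFin n (a : 'I_n -> 'I_n -> \bar R) (b : R) : (0 < n)%N ->
  \sum_(i < n) \sum_(j < n | j != i) (a i j + b%:E) =
  \sum_(i < n) \sum_(j < n | j != i) a i j + (n%:R * (n%:R - 1) * b)%:E.
Proof.
move=> n0; under eq_bigr do rewrite big_split /=.
rewrite big_split /=; congr (_ + _).
rewrite (eq_bigr (fun=> (n.-1%:R * b)%:E)) => [|i _]; last first.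
  by rewrite sumEFin sumr_const cardC1 card_ord mulr_natl.
rewrite sumEFin sumr_const card_ord; congr EFin.
by rewrite -[LHS]mulr_natl mulrA -natrB_pred.
Qed.

(** Only an inequality: there are [n * (n - 1)] ordered pairs, while the normalization is by
    [n ^ 2]. *)
Lemma pair_energy_addEFin (g : 'rV[R]_N -> \bar R) (b : R) n (x : 'I_n -> 'rV[R]_N) :
  (0 <= b)%R -> (0 < n)%N ->
  pair_energy (fun z => g z + b%:E) x <= pair_energy g x + b%:E.
Proof.
move=> b0 n0; have nR : (0 < n%:R :> R)%R by rewrite ltr0n.
rewrite /pair_energy sum_pair_addEFin// muleDr//; last by rewrite fin_num_adde_defl.
apply: leeD2l; rewrite -EFinM lee_fin.
rewrite ler_pdivrMl ?exprn_gt0// expr2; apply: ler_wpM2r => //.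
by apply: ler_wpM2l; [exact: ltW|rewrite gerBl].
Qed.

(** The error has two sources: the greedy slack [n] on unordered pairs, doubled, gives [2 / n], and
    the factor [1 - 1 / n] in front of the energy costs at most its absolute value divided by [n].
    The shift by [b] cancels exactly. *)
Lemma pair_energy_le_energy mu (g : 'rV[R]_N -> \bar R) (b : R) n :
  measurable_fun [set: borel_rV R N] g -> (forall z, (- b)%:E <= g z) ->
  (forall z, g z = g (- z)%R) -> energy g mu < +oo -> (0 < n)%N ->
  exists x : 'I_n -> 'rV[R]_N,
    pair_energy g x <= energy g mu + ((2 + `|fine (energy g mu)|) / n%:R)%:E.
Proof.
wlog b0 : b / (0 <= b)%R.
  move=> /(_ (Num.max b 0%R)) H mg gb; apply: H => //; first by rewrite le_max lexx orbT.
  by move=> z; apply: le_trans (gb z); rewrite lee_fin lerN2 le_max lexx.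
move=> mg gb gsym Eoo n0.
pose h z := g z + b%:E.
have h0 z : 0 <= h z by exact: addEFin_ge0.
have mh : measurable_fun [set: borel_rV R N] h by exact: emeasurable_funD.
have Eh : energy h mu = energy g mu + b%:E by exact: energy_addEFin.
have Efin : energy g mu \is a fin_num.
  rewrite fin_numE -ltey Eoo andbT gt_eqF//; apply: (@lt_le_trans _ _ (- b)%:E).
    exact: ltNyr.
  by rewrite EFinN -sub0e leeBlDr// -Eh; apply: integral_ge0 => y _; exact: integral_ge0.
have [x xn] := greedy_points mu mh h0 (leqnn n).
exists (fun i => x i); have nR : (0 < n%:R :> R)%R by rewrite ltr0n.
set e := fine (energy g mu); have eE : energy g mu = e%:E by rewrite /e fineK.
have Cn : ('C(n, 2)%:R * 2 = n%:R * (n%:R - 1) :> R)%R.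
  by rewrite natrB_pred// -!natrM mulnC -mul_bin_diag bin1.
move: xn; rewrite subnn mul0e adde0 bin_small// mul0e adde0 Eh eE.
rewrite -(EFinD e b) -EFinM -(EFinD (_ * _)%R) => xn.
have Sh : \sum_(i < n) \sum_(j < n | j != i) h (x i - x j)%R <=
    (n%:R * (n%:R - 1) * (e + b) + 2 * n%:R)%:E.
  rewrite (sum_offdiag _ (a := fun i j => h (x i - x j)%R)); last first.
    by move=> i j; rewrite /h gsym opprB.
  apply: (le_trans (leeD xn xn)); rewrite -EFinD lee_fin -Cn le_eqVlt; apply/orP; left.
  by apply/eqP; ring.
move: Sh; rewrite sum_pair_addEFin// -leeBrDr// => Sg.
rewrite /pair_energy; apply: (le_trans (lee_wpmul2l _ Sg)).
  by rewrite lee_fin invr_ge0 exprn_ge0.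
rewrite -EFinB -EFinM -EFinD lee_fin.
have -> : ((n%:R ^+ 2)^-1 * (n%:R * (n%:R - 1) * (e + b) + 2 * n%:R - n%:R * (n%:R - 1) * b)
   = e + (2 - e) / n%:R)%R by field; rewrite gt_eqF.
rewrite lerD2l ler_pM2r ?invr_gt0// lerD2l.
by rewrite -normrN ler_norm.
Qed.

End averaging.

(** * Almost everywhere convergent rearrangements *)

Lemma leq_homo_ltn (s : nat -> nat) : {homo s : m n / (m < n)%N} -> forall k, (k <= s k)%N.
Proof. by move=> smono; elim=> // k IH; apply: (leq_ltn_trans IH); exact: smono. Qed.

Lemma subsequence_of_frequently (P : nat -> nat -> Prop) :
  (forall j m, exists2 k, (m <= k)%N & P j k) ->
  exists2 s : nat -> nat, {homo s : m n / (m < n)%N} & forall j, P j (s j).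
Proof.
move=> H.
have /choice[f fP] : forall jm : nat * nat, exists k, (jm.2 <= k)%N /\ P jm.1 k.
  by move=> [j m]; have [k mk Pk] := H j m; exists k.
pose s := fix s j := if j is i.+1 then f (j, (s i).+1) else f (0%N, 0%N).
exists s.
  by apply: homo_ltn; [exact: ltn_trans|] => i; have [] := fP (i.+1, (s i).+1).
by case=> [|j]; [have [] := fP (0%N, 0%N)|have [] := fP (j.+1, (s j).+1)].
Qed.

Lemma frequently_pigeonhole (P : nat -> Prop) (u : nat -> nat) (B k0 : nat) :
  (forall m, exists2 k, (m <= k)%N & P k) ->
  (forall k, (k0 <= k)%N -> (u k <= B)%N) ->
  exists b, forall m, exists2 k, (m <= k)%N & P k /\ u k = b.
Proof.
move=> fP uB; apply: contrapT => /forallNP H.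
have /choice[f fP'] : forall b, exists m, forall k, (m <= k)%N -> P k -> u k <> b.
  move=> b; have /existsNP[m mP] := H b; exists m => k mk Pk ukb.
  by apply: mP; exists k.
pose M := maxn k0 (\max_(b < B.+1) f b).
have [k Mk Pk] := fP M.
have kk0 : (k0 <= k)%N by apply: leq_trans Mk; rewrite leq_maxl.
have ukB : (u k < B.+1)%N by rewrite ltnS uB.
apply: (fP' (Ordinal ukB) k) => //.
apply: leq_trans Mk; rewrite leq_max; apply/orP; right.
exact: (leq_bigmax_cond (F := fun b : 'I_B.+1 => f b)).
Qed.

(** Instead of nesting subsequences, one grows a list of values attained simultaneously at
    arbitrarily large [k]. The pigeonhole principle extends the list by one value, and the index of
    rank [j] is chosen to realize the first [j + 1] values. *)
Lemma diagonal_subsequence (u : nat -> nat -> nat) :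
  (forall a, exists B k0, forall k, (k0 <= k)%N -> (u a k <= B)%N) ->
  exists2 s : nat -> nat, {homo s : m n / (m < n)%N} &
    exists L : nat -> nat, forall a k, (a <= k)%N -> u a (s k) = L a.
Proof.
move=> ub.
pose good (l : seq nat) := forall m, exists2 k, (m <= k)%N &
  forall a, (a < size l)%N -> u a k = nth 0%N l a.
have step l : exists b, good l -> good (rcons l b).
  have [gl|ngl] := pselect (good l); last by exists 0%N.
  have [B [k0 uB]] := ub (size l).
  have [b Hb] := frequently_pigeonhole gl uB.
  exists b => _ m; have [k mk [kl ukb]] := Hb m; exists k => // a.
  rewrite size_rcons ltnS leq_eqVlt nth_rcons => /orP[/eqP ->|al].
    by rewrite ltnn eqxx.
  by rewrite al kl.
have /choice[f fP] := step.
pose l := fix l n := if n is m.+1 then rcons (l m) (f (l m)) else [::].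
have sl n : size (l n) = n by elim: n => //= n IH; rewrite size_rcons IH.
have gl n : good (l n).
  by elim: n => [m|n IH] /=; [exists m|exact: fP].
pose L a := nth 0%N (l a.+1) a.
have lL n a : (a < n)%N -> nth 0%N (l n) a = L a.
  elim: n => // n IH; rewrite ltnS leq_eqVlt => /orP[/eqP ->//|an].
  by rewrite /= nth_rcons sl an IH.
have [|s shomo sP] := @subsequence_of_frequently
    (fun j k => forall a, (a <= j)%N -> u a k = L a).
  move=> j m; have [k mk kP] := gl j.+1 m; exists k => // a aj.
  by rewrite kP ?sl ?lL.
by exists s => //; exists L => a k ak; exact: sP.
Qed.

Lemma sorting_perm n (c : 'I_n -> nat) :
  exists p : 'S_n, forall i j : 'I_n, (i <= j)%N -> (c (p i) <= c (p j))%N.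
Proof.
case: n c => [|n] c; first by exists 1%g => -[].
pose e := sort (relpre c leq) (enum 'I_n.+1).
have se : size e == n.+1 by rewrite size_sort size_enum_ord.
have /tuple_permP[p pE] : perm_eq (Tuple se) [tuple i | i < n.+1].
  by rewrite /= map_id perm_sort.
exists p => i j ij.
have nthp (k : 'I_n.+1) : nth ord0 e k = p k.
  have := congr1 (fun t => nth ord0 t k) pE; rewrite /= => ->.
  by rewrite (nth_map ord0) ?size_enum_ord// nth_ord_enum tnth_mktuple.
rewrite -!nthp; have tr : transitive (relpre c leq) by move=> ? ? ?; exact: leq_trans.
apply: (sorted_leq_nth tr) => //.
- by move=> ?; exact: leqnn.
- by apply: sort_sorted => x y; exact: leq_total.
- by rewrite inE (eqP se).
- by rewrite inE (eqP se).
Qed.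

(** * Nested integer codes of points *)

Section code.
Context {R : realType} {N : nat}.
Implicit Types x : 'rV[R]_N.

(* Comparison of one coordinate with one rational; [j] encodes the pair. *)
Definition threshold_bit (j : nat) (x : 'rV[R]_N) : bool :=
  if (unpickle j : option ('I_N * rat)) is Some (i, q) then ratr q <= x 0 i
  else false.

(* The codes are nested, see [code_half]: points sorted by [code k] are sorted
   by [code j] for every [j <= k]. *)
Fixpoint code (j : nat) (x : 'rV[R]_N) : nat :=
  if j is i.+1 then (threshold_bit i x + (code i x).*2)%N else Num.truncn `|x|.

Lemma code_half j x : code j x = (code j.+1 x)./2.
Proof. by rewrite /= half_bit_double. Qed.

Lemma code_bound j B x : (code 0 x <= B)%N -> (code j x <= 2 ^ j * B.+1)%N.
Proof.
move=> xS; apply: ltnW; elim: j => [|j IH]; first by rewrite mul1n ltnS.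
rewrite /= expnS -mulnA; move: IH; move: (2 ^ j * _)%N (code j x) => m c cm.
by case: (threshold_bit j x) => /=; rewrite -mul2n; lia.
Qed.

Lemma code_le j k x y : (j <= k)%N -> (code k x <= code k y)%N ->
  (code j x <= code j y)%N.
Proof.
move=> /subnK <-; elim: (k - j)%N => // d IH.
by rewrite addSn => h; apply: IH; rewrite !(code_half (d + j)); exact: half_leq.
Qed.

Lemma cvg_rV_coord (x_ : nat -> 'rV[R]_N) (x : 'rV[R]_N) :
  (forall i, x_ n 0 i @[n --> \oo] --> x 0 i) -> x_ @ \oo --> x.
Proof.
move=> H; apply/cvgrPdist_le => e e0.
have /choice[f fP] : forall i, exists m, forall n, (m <= n)%N -> `|x 0 i - x_ n 0 i| <= e.
  by move=> i; have /cvgrPdist_le/(_ e e0)[m _ mP] := H i; exists m.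
exists (\max_i f i) => // n /= fn; apply: ler_norm_coord => [|i]; first exact: ltW.
by rewrite !mxE; apply: fP; apply: leq_trans fn; exact: leq_bigmax.
Qed.

(** A bounded sequence that settles on one side of each rational cannot oscillate; its limit is the
    supremum of the rationals eventually below it. *)
Lemma cvg_threshold (u : nat -> R) (B : R) :
  (\forall n \near \oo, `|u n| <= B) ->
  (forall q : rat, exists b, \forall n \near \oo, (ratr q <= u n) = b) ->
  cvg (u n @[n --> \oo]).
Proof.
move=> uB uq.
pose A : set R := [set ratr q | q in [set q : rat | \forall n \near \oo, ratr q <= u n]].
have Aub : ubound A B.
  move=> _ [q qu <-]; near \oo => n.
  apply: (@le_trans _ _ (u n)); first by near: n.
  by apply: (le_trans (ler_norm _)); near: n.
have [q0 q0B] : exists q0 : rat, ratr q0 < - B.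
  have [q] := @rat_in_itvoo R (- B - 1) (- B) ltac:(by rewrite gtrDl ltrN10).
  by rewrite in_itv /= => /andP[_ qB]; exists q.
have A0 : A !=set0.
  exists (ratr q0), q0 => //=; near=> n; apply: ltW; apply: (lt_le_trans q0B).
  by rewrite lerNl; apply: (le_trans (ler_norm _)); rewrite normrN; near: n.
have supA : has_sup A by split => //; exists B.
apply/cvg_ex; exists (sup A); apply/cvgrPdist_lt => e e0.
have [_ [q1 q1A <-] q1e] := sup_adherent e0 supA.
have [q2] := @rat_in_itvoo R (sup A) (sup A + e) ltac:(by rewrite ltrDl).
rewrite in_itv /= => /andP[supq2 q2e].
have q2u : \forall n \near \oo, u n < ratr q2.
  have [[] ub] := uq q2; last first.
    by near=> n; rewrite ltNge; apply/negbT; near: n.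
  have : A (ratr q2) by exists q2 => //=; near=> n; near: n.
  by move=> /(sup_ubound (proj2 supA)) /(lt_le_trans supq2); rewrite ltxx.
near=> n; rewrite ltr_distlC; apply/andP; split.
  by apply: (lt_le_trans q1e); near: n.
by apply: lt_trans q2e; near: n.
Unshelve. all: by end_near. Qed.

(** [code 0] bounds the sequence, and the lowest bit of the code of rank [(pickle (i, q)).+1] is the
    comparison of coordinate [i] with [q]. *)
Lemma cvg_code (x_ : nat -> 'rV[R]_N) :
  (forall j, exists b, \forall n \near \oo, code j (x_ n) = b) -> cvg (x_ @ \oo).
Proof.
move=> H; have [B BP] := H 0%N.
have /choice[l lP] : forall i, exists l, x_ n 0 i @[n --> \oo] --> (l : R).
  move=> i; suff /cvg_ex : cvg (x_ n 0 i @[n --> \oo]) by [].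
  apply: (@cvg_threshold _ B.+1%:R).
    near=> n; apply: (le_trans (ler_coord_norm _ _)).
    have <- : code 0 (x_ n) = B by near: n.
    exact/ltW/truncnS_gt.
  move=> q; have [b bP] := H (pickle (i, q)).+1; exists (odd b).
  near=> n; have <- : code (pickle (i, q)).+1 (x_ n) = b by near: n.
  by rewrite /= oddD odd_double addbF /threshold_bit pickleK; case: (_ <= _).
apply/cvg_ex; exists (\row_i l i); apply: cvg_rV_coord => i.
by rewrite mxE.
Unshelve. all: by end_near. Qed.

End code.

(** * Finite lists read at constant speed *)

Section slot.
Context {R : realType}.

Definition slot (n : nat) (t : R) : nat := Num.truncn (n%:R * t).

Lemma slot_lt n t : (0 < n)%N -> 0 <= t < 1 -> (slot n t < n)%N.
Proof.
move=> n0 /andP[t0 t1]; rewrite truncn_lt_nat ?mulr_ge0//.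
by rewrite gtr_pMr// ltr0n.
Qed.

Lemma slot_le n t t' : t <= t' -> (slot n t <= slot n t')%N.
Proof. by move=> tt'; apply: le_truncn; rewrite ler_wpM2l. Qed.

Lemma slot_neq n t t' : 0 <= t -> 1 < n%:R * (t' - t) -> slot n t != slot n t'.
Proof.
move=> t0 ntt'; rewrite ltn_eqF//.
have nt0 : 0 <= n%:R * t by rewrite mulr_ge0.
rewrite /slot truncn_ge_nat; last by rewrite mulrBr in ntt'; lra.
have /andP[+ _] := truncn_itv nt0.
rewrite -addn1 natrD; rewrite mulrBr in ntt'; lra.
Qed.

Lemma measurable_slot_eq n k : measurable [set t : R | slot n t = k].
Proof.
have mM : measurable_fun [set: R] (fun t : R => n%:R * t) by exact: measurable_funM.
have mlt c : measurable [set t : R | n%:R * t < c].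
  by rewrite -[X in measurable X]setTI; exact: measurable_fun_ltr.
(* Negative numbers are truncated to [0], so slot [0] has no lower end. *)
case: k => [|k].
  rewrite (_ : [set _ | _] = [set t : R | n%:R * t < 1%:R]) //.
  by apply/seteqP; split => t /=; rewrite -truncn_le_nat leqn0 => /eqP.
rewrite (_ : [set _ | _] = [set t : R | n%:R * t < k.+2%:R] `\` [set t : R | n%:R * t < k.+1%:R]).
  exact: measurableD.
apply/seteqP; split => t /=.
  by move=> tk; split; rewrite -truncn_le_nat -/(slot n t) tk // ltnn.
rewrite -!truncn_le_nat -/(slot n t) => -[a b]; apply/eqP; rewrite eqn_leq a /=.
by rewrite ltnNge; apply/negP.
Qed.

Lemma measurable_slot d (T : measurableType d) n (F : nat -> T) :
  measurable_fun [set: R] (fun t => F (slot n t)).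
Proof.
move=> _ Y mY; rewrite setTI.
rewrite (_ : _ @^-1` _ = \bigcup_(k in [set k | Y (F k)]) [set t : R | slot n t = k]).
  apply: bigcup_measurable => k _; exact: measurable_slot_eq.
by apply/seteqP; split => [t Yt|t [k /= Yk tk]]; [exists (slot n t)|rewrite /= tk].
Qed.

Definition unif01 : probability (measurableTypeR R) R := uniform_prob (@ltr01 R).

#[global] Instance unif01_ae_filter : Filter (nbhs (almost_everywhere unif01)).
Proof. exact: ae_filter_ringOfSetsType. Qed.

Local Open Scope ereal_scope.

Lemma integral_slot n (F : nat -> \bar R) : (0 < n)%N -> (forall k, 0 <= F k) ->
  \int[unif01]_t F (slot n t) = (n%:R^-1)%:E * \sum_(i < n) F i.
Proof.
move=> n0 F0; have nR : (0 < n%:R :> R)%R by rewrite ltr0n.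
have mF : measurable_fun [set: R] (fun t => F (slot n t)) by exact: measurable_slot.
rewrite integral_uniform// subr0 invr1 mul1e.
rewrite -integral_itv_bndo_bndc; last exact: measurable_funS mF.
pose I (k : nat) : set R := `[(k%:R / n%:R)%R, (k.+1%:R / n%:R)%R[%classic.
have IE k t : (I k t) <-> (0 <= t)%R /\ slot n t = k.
  rewrite /I /= in_itv /= ler_pdivrMr// ltr_pdivlMr// mulrC.
  split => [kt|[t0 <-]]; last by apply: truncn_itv; rewrite mulr_ge0.
  have t0 : (0 <= t)%R.
    by move: kt => /andP[kt _]; rewrite -(pmulr_rge0 _ nR); exact: le_trans kt.
  by split => //; apply: truncn_def.
have -> : `[0%R, 1%R[%classic = \big[setU/set0]_(k <- iota 0 n) I k.
  rewrite -bigcup_seq; apply/seteqP; split => t /=.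
    rewrite in_itv /= => t01; exists (slot n t) => /=.
      by rewrite mem_iota add0n slot_lt.
    by apply/IE; case/andP: t01.
  move=> [k /=]; rewrite mem_iota add0n => kn /IE[t0 tk].
  rewrite in_itv /= t0 /= -(ltr_pM2l nR) mulr1 -truncn_lt_nat ?mulr_ge0//.
  by rewrite -/(slot n t) tk.
rewrite ge0_integral_bigsetU//; last 4 first.
- by move=> k; exact: measurable_itv.
- exact: iota_uniq.
- by move=> i j _ _ [t [/IE[_ <-] /IE[_ <-]]].
- exact: measurable_funS mF.
rewrite -(big_mkord xpredT F) /index_iota subn0 ge0_sume_distrr//.
apply: eq_bigr => k _; rewrite (eq_integral (fun=> F k)); last first.
  by move=> t; rewrite inE => /IE[_ ->].
rewrite integral_cst; last exact: measurable_itv.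
rewrite /= /I lebesgue_measure_itv /= lte_fin ltr_pM2r ?invr_gt0// ltr_nat ltnSn.
rewrite muleC -EFinB -mulrBl -[k.+1]addn1 natrD addrAC subrr add0r mul1r //.
Qed.

End slot.

Section step_function.
Context {R : realType} {N : nat}.

(* Junk value [0] outside the range; it is only met on a null set. *)
Definition nth_point n (x : 'I_n -> 'rV[R]_N) (i : nat) : 'rV[R]_N :=
  if insub i is Some j then x j else 0.

Lemma nth_pointE n (x : 'I_n -> 'rV[R]_N) (i : 'I_n) : nth_point x i = x i.
Proof. by rewrite /nth_point valK. Qed.

Definition step n (x : 'I_n -> 'rV[R]_N) (t : R) : 'rV[R]_N := nth_point x (slot n t).

Lemma code_step_le n (x : 'I_n -> 'rV[R]_N) k j (t t' : R) :
  (forall i i' : 'I_n, (i <= i')%N -> (code k (x i) <= code k (x i'))%N) ->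
  (j <= k)%N -> 0 <= t -> t <= t' -> t' < 1 -> (0 < n)%N ->
  (code j (step x t) <= code j (step x t'))%N.
Proof.
move=> xk jk t0 tt' t1 n0; apply: (code_le jk).
have st' : (slot n t' < n)%N by rewrite slot_lt// (le_trans t0).
have st : (slot n t < n)%N by rewrite slot_lt// t0 (le_lt_trans tt').
rewrite /step -[slot n t]/(val (Ordinal st)) -[slot n t']/(val (Ordinal st')) !nth_pointE.
by apply: xk; exact: slot_le.
Qed.

(** If the entry read at time [q] had a larger [code 0], so would all later entries, since the list
    is also sorted by [code 0]. Only the [slot n q <= q * n] earlier entries could then lie in the
    ball. *)
Lemma code0_step_le n (x : 'I_n -> 'rV[R]_N) k (q S : R) :
  (forall i i' : 'I_n, (i <= i')%N -> (code k (x i) <= code k (x i'))%N) ->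
  0 <= q < 1 -> (0 < n)%N -> q * n%:R < #|[set i | (`|x i| <= S)%R]%SET|%:R ->
  (code 0 (step x q) <= Num.truncn S)%N.
Proof.
move=> xk q01 n0 qS; rewrite leqNgt; apply/negP => Sx; move: qS.
have sq := slot_lt n0 q01; pose i0 := Ordinal sq.
have Sx' : (Num.truncn S < code 0 (x i0))%N by rewrite -(nth_pointE x i0).
have nq0 : 0 <= n%:R * q by rewrite mulr_ge0//; case/andP: q01.
apply/negP; rewrite -leNgt; apply: (@le_trans _ _ (slot n q)%:R); last first.
  by rewrite mulrC; have /andP[] := truncn_itv nq0.
have -> : slot n q = #|[set i : 'I_n | (i < slot n q)%N]%SET|.
  rewrite -[RHS]sum1_card (eq_bigl (fun i : 'I_n => (i < slot n q)%N)).
    by rewrite -(big_ord_widen n (fun=> 1%N) (ltnW sq)) sum1_card card_ord.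
  by move=> i; rewrite inE.
rewrite ler_nat.
apply: subset_leq_card; apply/fintype.subsetP => i; rewrite !inE => iS.
rewrite ltnNge; apply/negP => qi.
have : (code 0 (x i0) <= code 0 (x i))%N by apply: (@code_le _ _ 0 k) => //; exact: xk.
rewrite leqNgt => /negP; apply; apply: leq_ltn_trans Sx'.
exact: le_truncn.
Qed.

(* A jump at [t] is recorded by the least value of [L] to the right of [t], and
   distinct jumps have distinct records. *)
Lemma jumps_countable (L : rat -> nat) :
  (forall q q' : rat, 0 < (ratr q : R) -> q <= q' -> (ratr q' : R) < 1 -> (L q <= L q')%N) ->
  countable [set t : R | 0 < t < 1 /\ forall q q' : rat, 0 < (ratr q : R) ->
     (ratr q : R) < t -> t < (ratr q' : R) -> (ratr q' : R) < 1 -> (L q < L q')%N].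
Proof.
move=> Lmono; set D := [set t | _]; apply/countable_injP.
have /choice[m mP] : forall t : R, exists m : nat, D t ->
    (exists q', [/\ t < (ratr q' : R), (ratr q' : R) < 1 & L q' = m]) /\
    forall q', t < (ratr q' : R) -> (ratr q' : R) < 1 -> (m <= L q')%N.
  move=> t; have [Dt|nDt] := pselect (D t); last by exists 0%N.
  pose P := [set l | exists q', [/\ t < (ratr q' : R), (ratr q' : R) < 1 & L q' = l]].
  have exP : exists l, `[< P l >].
    have [_ /andP[_ t1]] := (I, Dt.1).
    have [q] := rat_in_itvoo t1; rewrite in_itv /= => /andP[tq q1].
    by exists (L q); apply/asboolP; exists q.
  have := ex_minnP exP; case=> l /asboolP Pl lmin; exists l => _; split => // q' tq' q'1.
  by apply: lmin; apply/asboolP; exists q'.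
have mlt t t' : D t -> D t' -> t < t' -> (m t < m t')%N.
  move=> Dt Dt' tt'.
  have [q] := rat_in_itvoo tt'; rewrite in_itv /= => /andP[tq qt'].
  have [_ mt] := mP _ Dt; have [[q' [t'q' q'1 <-]] _] := mP _ Dt'.
  apply: (@leq_ltn_trans (L q)); first by apply: mt => //; exact: lt_trans qt' (lt_trans t'q' q'1).
  apply: Dt'.2 => //; apply: lt_trans tq; by case: Dt => /andP[].
exists m => t t'; rewrite !in_setE => Dt Dt' mtt'.
have [tt'|t't|//] := ltgtP t t'.
  by have := mlt _ _ Dt Dt' tt'; rewrite mtt' ltnn.
by have := mlt _ _ Dt' Dt t't; rewrite mtt' ltnn.
Qed.

(** This is Helly's selection principle: for each [J] the code of rank [J] is eventually
    nondecreasing in time. Its values at rational times are made eventually constant by extraction,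
    and monotonicity transfers this to every time that is not a jump of the limit for some [J]. *)
Lemma ae_convergent_subsequence (n : nat -> nat) (x : forall k, 'I_(n k) -> 'rV[R]_N) :
  (forall k, (0 < n k)%N) ->
  (forall k (i j : 'I_(n k)), (i <= j)%N -> (code k (x k i) <= code k (x k j))%N) ->
  (forall eta : R, 0 < eta -> exists (S : R) k0, forall k, (k0 <= k)%N ->
     (1 - eta) * (n k)%:R < #|[set i | (`|x k i| <= S)%R]%SET|%:R) ->
  exists2 s : nat -> nat, {homo s : m n / (m < n)%N} &
    exists2 C : set R, countable C &
      forall t, 0 < t < 1 -> ~ C t -> cvg (step (x (s k)) t @[k --> \oo]).
Proof.
move=> n0 xmono tight.
pose u a k := if (unpickle a : option (nat * rat)) is Some (J, q) then
  if 0 < (ratr q : R) < 1 then code J (step (x k) (ratr q)) else 0%N else 0%N.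
have [a|s smono [L Ls]] := @diagonal_subsequence u.
  rewrite /u; case: (@unpickle (nat * rat)%type a) => [[J q]|]; last by exists 0%N, 0%N.
  case: (boolP (0 < (ratr q : R) < 1)) => [/andP[q0 q1]|_]; last by exists 0%N, 0%N.
  (* Tightness at level [1 - q] puts more than the fraction [q] of the points in one ball, so the
     entry read at time [q] stays bounded. *)
  have [|S [k0 Sk0]] := tight (1 - ratr q); first by rewrite subr_gt0.
  exists (2 ^ J * (Num.truncn S).+1)%N, k0 => k k0k.
  apply: code_bound; apply: (@code0_step_le _ _ k) => //; [exact: xmono|by rewrite (ltW q0) q1|].
  by have := Sk0 k k0k; rewrite subKr.
have sk := leq_homo_ltn smono.
pose l (J : nat) (q : rat) : nat := L (pickle (J, q)).
have lE J q : 0 < (ratr q : R) < 1 ->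
    \forall k \near \oo, code J (step (x (s k)) (ratr q)) = l J q.
  move=> q01; exists (pickle (J, q)) => // k /= /Ls; rewrite /l => <-.
  by rewrite /u pickleK q01.
have lmono J (q q' : rat) : 0 < (ratr q : R) -> q <= q' -> (ratr q' : R) < 1 ->
    (l J q <= l J q')%N.
  move=> q0 qq' q'1; have rqq' : (ratr q : R) <= ratr q' by rewrite ler_rat.
  near \oo => k.
  have <- : code J (step (x (s k)) (ratr q)) = l J q.
    by near: k; apply: lE; rewrite q0 (le_lt_trans rqq').
  have <- : code J (step (x (s k)) (ratr q')) = l J q'.
    by near: k; apply: lE; rewrite q'1 (lt_le_trans q0).
  apply: (@code_step_le _ _ (s k)) => //; [exact: xmono| |exact: ltW].
  by apply: leq_trans (sk k); near: k; exact: nbhs_infty_ge.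
pose D J := [set t : R | 0 < t < 1 /\ forall q q' : rat, 0 < (ratr q : R) ->
     (ratr q : R) < t -> t < (ratr q' : R) -> (ratr q' : R) < 1 -> (l J q < l J q')%N].
exists s => //; exists (\bigcup_J D J).
  by apply: bigcup_countable => // J _; apply: jumps_countable; exact: lmono.
move=> t t01 nDt; apply: cvg_code => J.
have : ~ D J t by move=> DJt; apply: nDt; exists J.
move=> /not_andP[//|] /existsNP[q] /existsNP[q'].
move=> /not_implyP[q0] /not_implyP[qt] /not_implyP[tq'] /not_implyP[q'1] /negP.
rewrite -leqNgt => ll.
(* As [t] is not a jump, the limit codes agree at two rationals surrounding [t]; the code at [t] is
   squeezed between them. *)
have lqq' : l J q = l J q'.
  apply/eqP; rewrite eqn_leq ll andbT lmono// -(ler_rat R).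
  exact/ltW/(lt_trans qt).
have t0 : 0 < t by case/andP: t01.
exists (l J q); near=> k.
have Jk : (J <= s k)%N.
  by apply: leq_trans (sk k); near: k; exact: nbhs_infty_ge.
apply/eqP; rewrite eqn_leq; apply/andP; split.
  rewrite lqq'; have <- : code J (step (x (s k)) (ratr q')) = l J q'.
    by near: k; apply: lE; rewrite q'1 (lt_trans t0).
  by apply: (@code_step_le _ _ (s k)) => //; [exact: xmono|exact: ltW|exact: ltW].
have <- : code J (step (x (s k)) (ratr q)) = l J q.
  by near: k; apply: lE; rewrite q0 (lt_trans qt)// (lt_trans tq').
apply: (@code_step_le _ _ (s k)) => //; [exact: xmono|exact: ltW|exact: ltW|].
by rewrite (lt_trans tq').
Unshelve. all: by end_near. Qed.

End step_function.

(** * Energy of the limit law *)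

Section limn_einf_bounds.
Local Open Scope ereal_scope.
Context {R : realType}.

Lemma limn_einf_le (u : (\bar R)^nat) (a : \bar R) :
  (\forall k \near \oo, u k <= a) -> limn_einf u <= a.
Proof.
move=> ua; rewrite /limn_einf -[leLHS]/(limf_einf u \oo) limf_einfE.
apply: ge_ereal_sup => _ [A ooA <-].
have [k [Ak uka]] : exists k, A k /\ u k <= a.
  by near \oo => k; exists k; split; near: k.
by apply: le_trans uka; apply: ereal_inf_lbound; exists k.
Unshelve. all: by end_near. Qed.

Lemma limn_einf_ge (u : (\bar R)^nat) (l : \bar R) :
  (forall a : R, a%:E < l -> \forall k \near \oo, a%:E <= u k) -> l <= limn_einf u.
Proof.
move=> H.
have H' a : a%:E < l -> a%:E <= limn_einf u.
  move=> /H ua; rewrite /limn_einf -[leRHS]/(limf_einf u \oo) limf_einfE.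
  apply: (@le_trans _ _ (ereal_inf (u @` [set k | a%:E <= u k]))).
    by apply: le_ereal_inf_tmp => _ [k /= uk <-].
  by apply: ereal_sup_ubound; exists [set k | a%:E <= u k].
case: l H H' => [l| |] _ H'; last by rewrite leNye.
- apply/lee_addgt0Pr => e e0; rewrite -leeBlDr//; apply: H'.
  by rewrite lte_fin ltrBlDr ltrDl.
- by rewrite leye_eq; apply/eqP/eqyP => a _; apply: H'; rewrite ltry.
Qed.

Lemma limn_einf_ge0 (u : (\bar R)^nat) : (forall k, 0 <= u k) -> 0 <= limn_einf u.
Proof.
move=> u0; apply: limn_einf_ge => a a0; apply: nearW => k.
exact: le_trans (ltW a0) (u0 k).
Qed.

Lemma cvge_near_gt (u : (\bar R)^nat) (l a : \bar R) :
  u @ \oo --> l -> a < l -> \forall k \near \oo, a < u k.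
Proof.
move=> ul al; apply: (ul [set y | a < y]); apply: open_nbhs_nbhs; split => //.
exact: open_ereal_gt_ereal.
Qed.

Lemma cvge_near_lt (u : (\bar R)^nat) (l a : \bar R) :
  u @ \oo --> l -> l < a -> \forall k \near \oo, u k < a.
Proof.
move=> ul la; apply: (ul [set y | y < a]); apply: open_nbhs_nbhs; split => //.
exact: open_ereal_lt_ereal.
Qed.

Lemma limn_einf_near_gt (u : (\bar R)^nat) (a : \bar R) :
  a < limn_einf u -> \forall k \near \oo, a < u k.
Proof.
rewrite /limn_einf -[ltRHS]/(limf_einf u \oo) limf_einfE => /ereal_sup_gt[_ [A ooA <-]] aA.
apply: filterS ooA => k Ak; apply: (lt_le_trans aA).
by apply: ereal_inf_lbound; exists k.
Qed.

Lemma limn_einf_frequently_lt (u : (\bar R)^nat) (a : \bar R) :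
  limn_einf u < a -> forall m, exists2 k, (m <= k)%N & u k < a.
Proof.
move=> ua m; apply: contrapT => H; move: ua; apply/negP; rewrite -leNgt.
apply: limn_einf_ge => c ca; exists m => // k /= mk; apply: (le_trans (ltW ca)).
by rewrite leNgt; apply/negP => uka; apply: H; exists k.
Qed.

Lemma cvge_squeeze (u : (\bar R)^nat) (l : R) :
  (forall e : R, (0 < e)%R -> \forall k \near \oo, (l - e)%:E <= u k <= (l + e)%:E) ->
  u @ \oo --> l%:E.
Proof.
move=> H; apply/fine_cvgP; split.
  apply: filterS (H 1%R ltr01) => k /andP[lu ul].
  by rewrite fin_real// (lt_le_trans (ltNyr _) lu) (le_lt_trans ul (ltry _)).
apply/cvgrPdist_le => e e0; apply: filterS (H e e0) => k /andP[lu ul] /=.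
have uf : u k \is a fin_num.
  by rewrite fin_real// (lt_le_trans (ltNyr _) lu) (le_lt_trans ul (ltry _)).
move: lu ul; rewrite -(fineK uf) !lee_fin /= => lu ul.
by rewrite ler_norml; apply/andP; split; lra.
Qed.

Lemma measurable_fun_limn_einf d (T : measurableType d) (D : set T) (f : (T -> \bar R)^nat) :
  (forall n, measurable_fun D (f n)) -> measurable_fun D (fun t => limn_einf (f ^~ t)).
Proof.
move=> mf; apply: (measurableT_comp (f := -%E)) => //.
apply: (@measurable_fun_limn_esup _ _ _ D (fun n t => - f n t)) => n.
exact: (measurableT_comp (f := -%E)).
Qed.

End limn_einf_bounds.

Lemma continuous_measurable_rV (R : realType) N (phi : 'rV[R]_N -> R) :
  continuous phi -> measurable_fun [set: borel_rV R N] (phi : borel_rV R N -> R).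
Proof.
move=> cphi; apply: (measurability _ (RGenOpens.measurableE R)).
move=> _ [_ [a [b ->] <-]]; rewrite setTI; apply: sub_gen_smallest.
by move/continuousP: cphi; apply; exact: interval_open.
Qed.

Lemma compact_support_bounded (R : realType) N (phi : 'rV[R]_N -> R) :
  continuous phi -> compact (closure [set x | phi x != 0]) ->
  exists B, forall x, `|phi x| <= B.
Proof.
move=> cphi cpt; set K := closure _ in cpt.
have /compact_bounded[M [_ HM]] : compact (phi @` K).
  by apply: continuous_compact => //; exact: continuous_subspaceT.
exists (`|M| + 1) => x; have [x0|x0] := eqVneq (phi x) 0.
  by rewrite x0 normr0 addr_ge0.
apply: HM; first by rewrite (le_lt_trans (ler_norm _))// ltrDl.
by exists x => //; apply: subset_closure.
Qed.

(** * Laws of step functions and of their limits *)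

Section step_law.
Local Open Scope ereal_scope.
Context {R : realType} {N : nat}.
Local Notation borelR := (measurableTypeR R).

(* [step] with the types that make it a random variable. *)
Definition step_rv n (x : 'I_n -> 'rV[R]_N) : borelR -> borel_rV R N := step x.

Lemma measurable_step_rv n (x : 'I_n -> 'rV[R]_N) :
  measurable_fun [set: borelR] (step_rv x).
Proof. exact: measurable_slot. Qed.

HB.instance Definition _ n x := isMeasurableFun.Build _ _ _ _ (@step_rv n x)
  (@measurable_step_rv n x).

Lemma empirical_step_rv n (x : 'I_n -> 'rV[R]_N) :
  (0 < n)%N -> is_empirical (distribution unif01 (step_rv x)) x.
Proof.
move=> n0 A mA; have mXA : measurable (step_rv x @^-1` A).
  by rewrite -[X in measurable X]setTI; exact: measurable_step_rv.
transitivity (\int[unif01]_t (\1_(step_rv x @^-1` A) t)%:E).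
  by rewrite integral_indic// setIT.
pose F k : \bar R := (\1_A (nth_point x k : borel_rV R N))%:E.
rewrite (eq_integral (fun t : borelR => F (slot n t))) => [|t _]; last first.
  by rewrite /F !indicE.
rewrite integral_slot// => [|k]; last by rewrite lee_fin.
congr (_ * _); apply: eq_bigr => i _.
by rewrite /F nth_pointE diracE indicE.
Qed.

Lemma unif01_ae (C : set R) : countable C ->
  {ae unif01, forall t, (0 < t < 1)%R /\ ~ C t}.
Proof.
(* Adjoining all natural numbers to [C] keeps the set countable; only the endpoints [0] and [1]
   matter. *)
move=> cC; pose Z : set borelR := \bigcup_i (if i is j.+1 then [set j%:R] else C).
have cZ : countable Z by apply: bigcup_countable => // -[|j] _ //; exact: countable1.
have mZ : measurable Z by apply: countable_measurable => //.
pose O : set borelR := Z `|` ~` `[0%R, 1%R]%classic.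
have mO : measurable O.
  by apply: measurableU => //; apply: measurableC; exact: measurable_itv.
exists O; split => //.
- rewrite /unif01 /= /uniform_prob integral_uniform_pdf.
  apply: null_set_integral.
  + by apply: measurableI => //; exact: measurable_itv.
  + by apply/measurable_funTS/measurable_EFinP; exact: measurable_uniform_pdf.
  + apply: countable_lebesgue_measure0; apply: sub_countable cZ; apply: subset_card_le.
    by move=> t [[//|nt] t01].
- move=> t /= nt; apply: contrapT => /not_orP[nZ].
  rewrite /setC /= in_itv /= => /contrapT /andP[t0' t1']; apply: nt; split.
    rewrite !lt_neqAle t0' t1' !andbT eq_sym; apply/andP; split; apply/eqP => tE.
      by apply: nZ; exists 1%N.
    by apply: nZ; exists 2%N.
  by move=> Ct; apply: nZ; exists 0%N.
Qed.

Lemma measurable_limit_step (n : nat -> nat) (x : forall k, 'I_(n k) -> 'rV[R]_N) (C : set R) :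
  countable C ->
  (forall t, (0 < t < 1)%R -> ~ C t -> cvg (step (x k) t @[k --> \oo])) ->
  exists2 X : R -> 'rV[R]_N, measurable_fun [set: borelR] (X : borelR -> borel_rV R N) &
    forall t, (0 < t < 1)%R -> ~ C t -> step (x k) t @[k --> \oo] --> X t.
Proof.
move=> cC cvgx; pose D : set borelR := `]0%R, 1%R[%classic `\` C.
have mC : measurable (C : set borelR) by apply: countable_measurable.
have mD : measurable D by apply: measurableD => //; exact: measurable_itv.
have DP t : (0 < t < 1)%R -> ~ C t -> t \in D.
  by move=> t01 Ct; rewrite inE; split; rewrite //= in_itv.
(* With the value [0] off [D], [X] is an everywhere limit of the step functions restricted to [D],
   hence measurable. *)
pose X t : 'rV[R]_N := if t \in D then lim (step (x k) t @[k --> \oo]) else 0%R.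
have Xcvg t : t \in D -> step (x k) t @[k --> \oo] --> X t.
  move=> tD; rewrite /X tD; move: tD; rewrite inE => -[/= + Ct].
  by rewrite in_itv => t01; exact: cvgx.
exists X => [|t t01 Ct]; last by apply: Xcvg; exact: DP.
apply: measurable_rV => i.
apply: (@measurable_fun_cvg _ _ _ _ (fun k => (fun t => step (x k) t 0%R i) \_ D)) => [k|t _].
  apply/(measurable_restrictT _ mD); apply: measurable_funTS.
  exact: (measurable_slot (n k) (fun j => nth_point (x k) j 0%R i)).
have [tD|tD] := boolP (t \in D); last first.
  rewrite (_ : (fun _ => _) = fun=> 0%R).
    by rewrite /X (negbTE tD) mxE; exact: cvg_cst.
  by apply/funext => k; rewrite patchE (negbTE tD).
rewrite (_ : (fun _ => _) = fun k => step (x k) t 0%R i).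
  exact: (cvg_comp _ _ (Xcvg t tD) (@coord_continuous R 1 N 0%R i (X t))).
by apply/funext => k; rewrite patchE tD.
Qed.

End step_law.

Section limit_law.
Local Open Scope ereal_scope.
Context {R : realType} {N : nat}.
Local Notation borelR := (measurableTypeR R).
Variables (n : nat -> nat) (x : forall k, 'I_(n k) -> 'rV[R]_N).
Arguments x : clear implicits.
Variable X : {mfun borelR >-> borel_rV R N}.
Hypothesis n_ge : forall k, (k < n k)%N.
Hypothesis x_cvg : {ae unif01, forall t, step (x k) t @[k --> \oo] --> (X t : 'rV[R]_N)}.

Let n_gt0 k : (0 < n k)%N. Proof. exact: leq_ltn_trans (n_ge k). Qed.

Lemma weak_star_cvg_limit_law (nu : nat -> probability (borel_rV R N) R) :
  (forall k, is_empirical (nu k) (x k)) -> weak_star_cvg nu (distribution unif01 X).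
Proof.
move=> nux phi cphi cpt.
have mphi := continuous_measurable_rV cphi.
have mEphi : measurable_fun [set: borel_rV R N] (EFin \o phi) by exact/measurable_EFinP.
have [B phiB] := compact_support_bounded cphi cpt.
have integ (Y : {mfun borelR >-> borel_rV R N}) :
    unif01.-integrable [set: borelR] ((EFin \o phi) \o Y).
  apply: measurable_bounded_integrable => //.
  - by apply: (@le_lt_trans _ _ 1); [exact: probability_le1|exact: ltry].
  - exact: measurableT_comp.
  - exists B; split; first exact: num_real.
    by move=> M BM y _ /=; apply: le_trans (ltW BM).
have nuE k : \int[nu k]_y (phi y)%:E = \int[unif01]_t (phi (step (x k) t))%:E.
  rewrite (eq_measure_integral (distribution unif01 (step_rv (x k)))); last first.
    move=> A mA _.
    exact: etrans (nux k A mA) (esym (empirical_step_rv (x k) (n_gt0 k) mA)).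
  by rewrite integral_distribution//; exact: integ.
rewrite (_ : (fun _ => _) = fun k => \int[unif01]_t (phi (step (x k) t))%:E); last first.
  by apply/funext => k; exact: nuE.
have -> : \int[distribution unif01 X]_y (phi y)%:E = \int[unif01]_t (phi (X t))%:E.
  by rewrite integral_distribution//; exact: integ.
have [] := @dominated_convergence _ borelR R unif01 setT measurableT
  (fun k t => (phi (step (x k) t))%:E) (fun t => (phi (X t))%:E) (cst B%:E).
- move=> k; apply/measurable_EFinP.
  exact: (measurable_slot (n k) (fun j => phi (nth_point (x k) j))).
- apply/measurable_EFinP; exact: measurableT_comp.
- move: x_cvg; apply: filterS => t xt _; apply: cvg_EFin; first exact: nearW.
  exact: (cvg_comp _ _ xt (cphi (X t))).
- exact: finite_measure_integrable_cst.
- by apply: aeW => t k _ /=; rewrite lee_fin.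
- by move=> _ _; exact.
Qed.

Lemma energy_limit_law (g : 'rV[R]_N -> \bar R) (b a : R) :
  measurable_fun [set: borel_rV R N] g -> (forall z, (- b)%:E <= g z) -> (0 <= b)%R ->
  lower_semicontinuous g -> (forall z, g z = g (- z)%R) ->
  (\forall k \near \oo, pair_energy g (x k) <= a%:E) ->
  energy g (distribution unif01 X) <= a%:E.
Proof.
move=> mg gb b0 glsc gsym xa; set mu := distribution unif01 X.
pose h z := g z + b%:E.
have h0 z : 0 <= h z by exact: addEFin_ge0.
have mh : measurable_fun [set: borel_rV R N] h by exact: emeasurable_funD.
have hsym z : h z = h (- z)%R by rewrite /h gsym.
have Eh : energy h mu = energy g mu + b%:E.
  exact: energy_addEFin.
suff : energy h mu <= (a + b)%:E by rewrite Eh EFinD leeD2rE.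
(* Removing the pairs of times that fall in the same slot removes the diagonal
   of the double sum, and nothing in the limit. *)
pose H k s t := if slot (n k) s == slot (n k) t then 0 else
  h (step (x k) s - step (x k) t)%R.
have H0 k s t : 0 <= H k s t by rewrite /H; case: ifP.
have mH k t : measurable_fun [set: borelR] (fun s => H k s t).
  exact: (measurable_slot (n k) (fun i => if i == slot (n k) t then 0 else
    h (nth_point (x k) i - nth_point (x k) (slot (n k) t))%R)).
(* The inner integral depends on [t] only through its slot, so the outer integral is again a finite
   sum. *)
pose F k j := \int[unif01]_s (if slot (n k) s == j then 0 else
    h (nth_point (x k) (slot (n k) s) - nth_point (x k) j)%R).
have FE k t : \int[unif01]_s H k s t = F k (slot (n k) t) by [].
have F0 k j : 0 <= F k j by apply: integral_ge0 => s _; case: ifP.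
have mF k : measurable_fun [set: borelR] (fun t => F k (slot (n k) t)).
  exact: measurable_slot.
(* The double time integral is exactly the pair energy of [h]; the inequality only comes from the
   shift by [b]. *)
have IF k : \int[unif01]_t F k (slot (n k) t) <= pair_energy g (x k) + b%:E.
  apply: le_trans (pair_energy_addEFin _ _ b0 (n_gt0 k)).
  rewrite integral_slot// /pair_energy expr2 invfM EFinM -muleA.
  rewrite le_eqVlt; apply/orP; left; apply/eqP; congr (_ * _).
  rewrite ge0_sume_distrr => [|i _]; last by apply: sume_ge0 => j _; exact: h0.
  apply: eq_bigr => i _.
  pose f j := if j == i :> nat then 0 else h (nth_point (x k) j - nth_point (x k) i)%R.
  rewrite /F (integral_slot (F := f)) => //; last by rewrite /f => j; case: ifP.
  congr (_ * _); rewrite [RHS]big_mkcond /=; apply: eq_bigr => j _.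
  by rewrite /f !nth_pointE -val_eqE /=; case: eqP => //= _; rewrite /h gsym opprB.
have lscH : {ae unif01, forall t, {ae unif01, forall s,
    h ((X s : 'rV[R]_N) - (X t : 'rV[R]_N))%R <= limn_einf (fun k => H k s t)}}.
  have ae01 := unif01_ae (countable1 (0 : R)%R).
  move: x_cvg ae01; apply: filterS2 => t xt [/andP[t0 _] _].
  move: (unif01_ae (countable1 t)) x_cvg; apply: filterS2 => s [/andP[s0 _] st] xs.
  apply: limn_einf_ge => c ch.
  have /glsc[V XV Vc] : (c - b)%:E < g ((X s : 'rV[R]_N) - (X t : 'rV[R]_N))%R.
    by rewrite EFinB lteBlDr.
  have st0 : (0 < `|s - t|)%R by rewrite normr_gt0 subr_eq0; exact/eqP.
  near=> k.
  have -> : H k s t = h (step (x k) s - step (x k) t)%R.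
    rewrite /H ifF//; apply/negbTE.
    (* As [n k] exceeds [k], two distinct times eventually lie in distinct slots. *)
    have kst : (1 < (n k)%:R * `|s - t|)%R.
      rewrite -ltr_pdivrMr// (@lt_le_trans _ _ k%:R%R)//.
        by near: k; exact: nbhs_infty_gtr.
      by rewrite ler_nat ltnW.
    have [lst|lts|/st//] := ltgtP s t.
      by apply: slot_neq; [exact: ltW|move: kst; rewrite distrC gtr0_norm// subr_gt0].
    by rewrite eq_sym; apply: slot_neq; [exact: ltW|move: kst; rewrite gtr0_norm// subr_gt0].
  rewrite /h -leeBlDr// -EFinB; apply: ltW; apply: Vc.
  near: k; exact: (cvgB xs xt XV).
have mpot : measurable_fun [set: borel_rV R N] (potential mu h).
  exact: measurable_potential.
have pot0 y : 0 <= potential mu h y by exact: integral_ge0.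
have -> : energy h mu = \int[unif01]_t potential mu h (X t).
  by rewrite /energy ge0_integral_distribution.
have msh (y : 'rV[R]_N) : measurable_fun [set: borelR] (fun s => h ((X s : 'rV[R]_N) - y)%R).
  exact: (measurableT_comp (measurable_shift y mh) (measurable_funP X)).
have potE y : potential mu h y = \int[unif01]_s h ((X s : 'rV[R]_N) - y)%R.
  by rewrite /potential ge0_integral_distribution//; exact: measurable_shift.
apply: (@le_trans _ _ (\int[unif01]_t limn_einf (fun k => F k (slot (n k) t)))).
  apply: ae_ge0_le_integral => //.
  - exact: (measurableT_comp mpot (measurable_funP X)).
  - by move=> t _; exact: limn_einf_ge0.
  - exact: measurable_fun_limn_einf.
  move: lscH; apply: filterS => t Ht _; rewrite potE.
  apply: (@le_trans _ _ (\int[unif01]_s limn_einf (fun k => H k s t))).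
    apply: ae_ge0_le_integral => //.
    - by move=> s _; exact: limn_einf_ge0.
    - exact: measurable_fun_limn_einf.
    by move: Ht; apply: filterS => s Hs _.
  exact: fatou.
apply: (le_trans (fatou unif01 measurableT mF (fun k t _ => F0 k _))).
apply: limn_einf_le; apply: filterS xa => k xa; rewrite EFinD.
by apply: (le_trans (IF k)); exact: leeD2r.
Unshelve. all: by end_near. Qed.

End limit_law.

(** * Weak-star limits and tightness *)

Section cutoff.
Context {R : realType} {N : nat}.
Implicit Types (d : 'rV[R]_N -> R) (K r : R).

(** For a continuous [d] that is positive exactly on an open set, these compactly supported
    functions tend pointwise to the indicator of that set as [K] and [r] grow. *)
Definition cutoff d K r (x : 'rV[R]_N) : R :=
  Num.min 1 (Num.max 0 (K * Num.min (d x) (r - `|x|))).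

Lemma cutoff_ge0 d K r x : 0 <= cutoff d K r x.
Proof. by rewrite le_min ler01 le_max lexx. Qed.

Lemma cutoff_le1 d K r x : cutoff d K r x <= 1.
Proof. by rewrite ge_min lexx. Qed.

Lemma cutoff_eq0 d K r x : 0 <= K -> d x <= 0 \/ r <= `|x| -> cutoff d K r x = 0.
Proof.
move=> K0 H; have le0 : K * Num.min (d x) (r - `|x|) <= 0.
  by apply: mulr_ge0_le0 => //; rewrite ge_min subr_le0; case: H => ->; rewrite ?orbT.
by rewrite /cutoff (max_l le0) min_r.
Qed.

Lemma cutoff_eq1 d K r x : 1 <= K * d x -> 1 <= K * (r - `|x|) -> cutoff d K r x = 1.
Proof.
by move=> Kd Kr; rewrite /cutoff min_l// le_max; apply/orP; right; rewrite /Num.min; case: ifP.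
Qed.

Lemma continuous_cutoff d K r : continuous d -> continuous (cutoff d K r).
Proof.
move=> cd; apply: min_fun_continuous; first exact: cst_continuous.
apply: max_fun_continuous; first exact: cst_continuous.
have cm : continuous (fun x : 'rV[R]_N => Num.min (d x) (r - `|x|)).
  apply: min_fun_continuous => // x.
  by apply: (@continuousB _ _ _ (cst r)); [exact: cst_continuous|exact: norm_continuous].
by move=> x; exact: (cvgM (cvg_cst K) (cm x)).
Qed.

Lemma compact_support_cutoff d K r : 0 <= K ->
  compact (closure [set x | cutoff d K r x != 0]).
Proof.
move=> K0; apply: bounded_closed_compact; last exact: closed_closure.
have cb : closed [set x : 'rV[R]_N | `|x| <= r].
  have /continuous_closedP cn : continuous (fun x : 'rV[R]_N => `|x|) by exact: norm_continuous.
  exact: (cn _ (@closed_le R r)).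
have sub : closure [set x | cutoff d K r x != 0] `<=` [set x : 'rV[R]_N | `|x| <= r].
  rewrite closureE => x; apply; split => // y /= y0.
  by rewrite leNgt; apply: contra y0 => ry; apply/eqP/cutoff_eq0 => //; right; exact: ltW.
exists r; split; first exact: num_real.
by move=> M rM x /sub /= xr; rewrite (le_trans xr)// ltW.
Qed.

(** The gauge is the distance to the complement of [U], which is 1-Lipschitz, or the constant [1] if
    the complement is empty. *)
Lemma open_gauge (U : set 'rV[R]_N) : open U ->
  exists2 d : 'rV[R]_N -> R, continuous d &
    (forall x, U x -> 0 < d x) /\ (forall x, ~ U x -> d x <= 0).
Proof.
move=> oU; have [[z0 z0U]|noU] := pselect (exists z, ~ U z); last first.
  exists (cst 1); first exact: cst_continuous.
  split=> x xU //=; by case: noU; exists x.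
pose A x : set R := [set `|x - z| | z in ~` U].
pose d x := inf (A x).
have A0 x : has_inf (A x).
  by split; [exists `|x - z0|, z0|exists 0 => _ [z _ <-]].
have dle x z : ~ U z -> d x <= `|x - z| by move=> zU; apply: ge_inf; [exact: (A0 x).2|exists z].
have dlip x y : d x <= d y + `|x - y|.
  rewrite -lerBlDr; apply: lb_le_inf; first exact: (A0 y).1.
  move=> _ [z zU <-]; rewrite lerBlDr (le_trans (dle x z zU))//.
  by rewrite [leRHS]addrC -[x - z](subrKA y) ler_normD.
exists d.
  move=> x; apply/(@cvgrPdist_le _ _ _ (nbhs (x : 'rV[R]_N)) (nbhs_filter x)) => e e0; near=> y.
  have xy : `|x - y| <= e.
    near: y; apply/nbhs_ballP; exists e => //= y; rewrite -ball_normE /=; exact: ltW.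
  rewrite ler_norml; have := dlip x y; have := dlip y x; rewrite [`|y - x|]distrC.
  by move=> ? ?; apply/andP; split; lra.
split=> x xU; last by have := dle x x xU; rewrite subrr normr0.
move: oU; rewrite openE => /(_ _ xU) /nbhs_ballP[e /= e0 eU].
apply: (lt_le_trans e0); apply: lb_le_inf; first exact: (A0 x).1.
move=> _ [z zU <-]; rewrite leNgt; apply/negP => xz; apply: zU; apply: eU.
by rewrite -ball_normE.
Unshelve. all: by end_near. Qed.
End cutoff.

Section weak_star.
Local Open Scope ereal_scope.
Context {R : realType} {N : nat}.
Implicit Types (nu : nat -> probability (borel_rV R N) R).
Implicit Types (mu : probability (borel_rV R N) R).

Lemma measurable_ball_rV (S : R) :
  measurable ([set z : 'rV[R]_N | (`|z| <= S)%R] : set (borel_rV R N)).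
Proof.
have mn := continuous_measurable_rV (@norm_continuous R 'rV[R]_N).
rewrite (_ : [set z | _] = (fun z : 'rV[R]_N => `|z|%R) @^-1` `]-oo, S]%classic).
  by rewrite -[X in measurable X]setTI; exact: mn.
by apply/seteqP; split => z /=; rewrite in_itv.
Qed.

Definition tight nu := forall eta : R, (0 < eta)%R -> exists (S : R) k0, forall k, (k0 <= k)%N ->
  (1 - eta)%:E < nu k [set z : 'rV[R]_N | (`|z| <= S)%R].

(** Compactly supported test functions do not see mass escaping to infinity, but the limit is a
    probability: one cutoff captures more than [1 - eta] of its mass, hence eventually of the mass
    of [nu k]. *)
Lemma weak_star_cvg_tight nu mu : weak_star_cvg nu mu -> tight nu.
Proof.
move=> numu eta eta0; pose B (S : R) : set (borel_rV R N) := [set z : 'rV[R]_N | (`|z| <= S)%R].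
have mB S : measurable (B S) by exact: measurable_ball_rV.
have [S muS] : exists S : nat, (1 - eta)%:E < mu (B S%:R%R).
  have BT : \bigcup_S B S%:R%R = [set: borel_rV R N].
    apply/seteqP; split => // z _; exists (Num.truncn `|z : 'rV[R]_N|).+1 => //.
    exact/ltW/truncnS_gt.
  have cvgB : mu (B S%:R%R) @[S --> \oo] --> 1.
    rewrite -(probability_setT mu) -BT; apply: nondecreasing_cvg_mu => //.
      by rewrite BT.
    move=> n m nm; apply/subsetPset => z /= zn; apply: (le_trans zn).
    by rewrite ler_nat.
  have : \forall S \near \oo, (1 - eta)%:E < mu (B S%:R%R).
    by apply: (cvge_near_gt cvgB); rewrite lte_fin gtrBl.
  by move=> [m _ mP]; exists m; exact: mP (leqnn m).
pose phi := cutoff (cst 1%R : 'rV[R]_N -> R) 1 (S%:R + 1).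
have cphi : continuous phi by apply: continuous_cutoff; exact: cst_continuous.
have mphi := continuous_measurable_rV cphi.
have phimu : (1 - eta)%:E < \int[mu]_x (phi x)%:E.
  apply: (lt_le_trans muS); rewrite -[X in mu X]setIT -integral_indic//.
  apply: ge0_le_integral => //.
  - by apply/measurable_EFinP; exact: measurable_indic.
  - exact/measurable_EFinP.
  - move=> x _; rewrite lee_fin indicE; case: (boolP (x \in _)) => [|_]; last exact: cutoff_ge0.
    rewrite inE /= => xS; rewrite /phi cutoff_eq1//= ?mul1r//.
    by rewrite addrAC lerDr subr_ge0.
have := numu phi cphi (@compact_support_cutoff R N _ _ _ ler01).
move=> /cvge_near_gt/(_ phimu)[k0 _ k0P]; exists (S%:R + 1)%R, k0 => k /k0P /= phik.
apply: (lt_le_trans phik); rewrite -[X in nu k X]setIT -integral_indic//; last exact: mB.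
apply: ge0_le_integral => //.
- by move=> y _; rewrite lee_fin cutoff_ge0.
- exact/measurable_EFinP.
- by apply/measurable_EFinP; exact: measurable_indic (mB _).
- move=> x _; rewrite lee_fin indicE; case: (boolP (x \in _)) => [_|]; first exact: cutoff_le1.
  rewrite notin_setE /= => /negP; rewrite -ltNge => Sx.
  by rewrite /phi cutoff_eq0//; right; exact: ltW.
Qed.

(** Open sets form a generating class stable under intersection, and their measures are limits of
    integrals of cutoffs. This identifies a given limit point with a limit found by extraction. *)
Lemma weak_star_cvg_unique nu mu mu' : weak_star_cvg nu mu -> weak_star_cvg nu mu' ->
  forall A, measurable A -> mu A = mu' A.
Proof.
move=> numu numu'.
apply: (@measure_unique _ _ (borel_rV R N) (@open 'rV[R]_N) (fun=> setT)) => //.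
- by move=> A B; exact: openI.
- by move=> _; exact: openT.
- by apply/seteqP; split => // z _; exists 0%N.
- move=> U oU; have [d cd [dU dCU]] := open_gauge oU.
  have mU : measurable (U : set (borel_rV R N)) by exact: sub_gen_smallest.
  pose phi (k : nat) := cutoff d k%:R k%:R.
  have cphi k : continuous (phi k) by exact: continuous_cutoff.
  have key (m : probability (borel_rV R N) R) : \int[m]_x (phi k x)%:E @[k --> \oo] --> m U.
    rewrite -[X in _ --> m X]setIT -integral_indic//.
    have [] := @dominated_convergence _ (borel_rV R N) R m setT measurableT
      (fun k x => (phi k x)%:E) (fun x => (\1_U x)%:E) (cst 1%:E).
    + by move=> k; apply/measurable_EFinP; exact: continuous_measurable_rV.
    + by apply/measurable_EFinP; exact: measurable_indic.
    + apply: aeW => x _; apply: cvg_near_cst.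
      have [Ux|Ux] := pselect (U x); last first.
        near=> k; rewrite /phi cutoff_eq0//; first by rewrite indicE memNset.
        by left; exact: dCU.
      have dx := dU x Ux; near=> k; rewrite indicE mem_set// /phi cutoff_eq1//.
        by rewrite -ler_pdivrMr// div1r ltW//; near: k; exact: nbhs_infty_gtr.
      have xk : (`|x : 'rV[R]_N| + 1 < k%:R)%R by near: k; exact: nbhs_infty_gtr.
      have x0 : (0 <= `|x : 'rV[R]_N|)%R by [].
      by rewrite -[X in (X <= _)%R]mulr1; apply: ler_pM => //; move: xk x0; lra.
    + exact: finite_measure_integrable_cst.
    + by apply: aeW => x k _ /=; rewrite lee_fin ger0_norm ?cutoff_ge0 ?cutoff_le1.
    + by move=> _ _.
  have e : (fun k => \int[mu]_x (phi k x)%:E) = (fun k => \int[mu']_x (phi k x)%:E).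
    apply/funext => k.
    have cpt : compact (closure [set x | phi k x != 0%R]) by exact: compact_support_cutoff.
    exact: (cvg_unique _ (numu _ (cphi k) cpt) (numu' _ (cphi k) cpt)).
  by have := key mu; rewrite e => H; exact: (cvg_unique _ H (key mu')).
- by move=> _; apply: (@le_lt_trans _ _ 1); [exact: probability_le1|exact: ltry].
Unshelve. all: by end_near. Qed.

End weak_star.

(** * Conclusion *)

Section empirical.
Local Open Scope ereal_scope.
Context {R : realType} {N : nat}.
Implicit Types (mu nu : probability (borel_rV R N) R) (g : 'rV[R]_N -> \bar R).

Lemma is_empirical_comp_perm n nu (x : 'I_n -> 'rV[R]_N) (p : 'S_n) :
  is_empirical nu x -> is_empirical nu (fun i => x (p i)).
Proof.
move=> nux A mA; rewrite nux//; congr (_ * _).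
by rewrite (reindex_inj (@perm_inj _ p)).
Qed.

Lemma is_empirical_translate n nu (x : 'I_n -> 'rV[R]_N) y :
  is_empirical nu x -> is_empirical (translate y nu) (fun i => x i - y)%R.
Proof.
move=> nux A mA; have mA' : measurable (subrV y @^-1` A).
  by rewrite -[X in measurable X]setTI; exact: measurable_subrV.
exact: nux.
Qed.

Lemma pair_energy_translate g n (x : 'I_n -> 'rV[R]_N) y :
  pair_energy g (fun i => x i - y)%R = pair_energy g x.
Proof.
congr (_ * _); apply: eq_bigr => i _; apply: eq_bigr => j _.
by rewrite opprB addrA subrK.
Qed.

Lemma empirical_ball n nu (x : 'I_n -> 'rV[R]_N) (S : R) : is_empirical nu x ->
  nu [set z : 'rV[R]_N | (`|z| <= S)%R] =
  (n%:R^-1 * #|[set i | (`|x i| <= S)%R]%SET|%:R)%:E.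
Proof.
move=> nux; apply: etrans (nux _ (measurable_ball_rV S)) _.
rewrite EFinM; congr (_ * _); rewrite -sum1_card natr_sum -sumEFin [RHS]big_mkcond /=.
apply: eq_bigr => i _; rewrite diracE inE.
by case: ifPn => xS; [rewrite mem_set|rewrite memNset//; exact/negP].
Qed.

Lemma empirical_ball_gt n nu (x : 'I_n -> 'rV[R]_N) (S a : R) : (0 < n)%N ->
  is_empirical nu x ->
  (a%:E < nu [set z : 'rV[R]_N | (`|z| <= S)%R]) =
  (a * n%:R < #|[set i | (`|x i| <= S)%R]%SET|%:R)%R.
Proof.
move=> n0 nux; rewrite (empirical_ball S nux) lte_fin mulrC ltr_pdivlMr//.
by rewrite ltr0n.
Qed.

Lemma discrete_energy_finite g n nu : discrete_energy g n nu < +oo ->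
  exists x : 'I_n -> 'rV[R]_N, is_empirical nu x.
Proof. by rewrite /discrete_energy; case: pselect => // -[x xnu] _; exists x. Qed.

Lemma pair_energy_ge g (b : R) n (x : 'I_n -> 'rV[R]_N) : (0 <= b)%R ->
  (forall z, (- b)%:E <= g z) -> (- b)%:E <= pair_energy g x.
Proof.
move=> b0 gb; case: n x => [|n] x.
  by rewrite /pair_energy big_ord0 mule0 lee_fin oppr_le0.
have S0 : 0 <= \sum_i \sum_(j | j != i) (g (x i - x j)%R + b%:E).
  by apply: sume_ge0 => i _; apply: sume_ge0 => j _; exact: addEFin_ge0.
have := @pair_energy_addEFin R N g b _ x b0 isT; rewrite EFinN -sub0e leeBlDr//.
by apply: le_trans; rewrite mule_ge0// lee_fin invr_ge0 exprn_ge0.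
Qed.

Lemma discrete_energy_ge g (b : R) n nu : (0 <= b)%R ->
  (forall z, (- b)%:E <= g z) -> (- b)%:E <= discrete_energy g n nu.
Proof.
move=> b0 gb; rewrite /discrete_energy; case: pselect => [xP|_].
  exact: pair_energy_ge.
exact: leey.
Qed.

Lemma min_discrete_energy_le g n (x : 'I_n -> 'rV[R]_N) : (0 < n)%N ->
  min_discrete_energy g n <= pair_energy g x.
Proof.
move=> n0; rewrite -(discrete_energyE g (empirical_step_rv x n0)).
by apply: ereal_inf_lbound; exists (distribution unif01 (step_rv x)).
Qed.

Lemma energy_eq g mu nu : (forall A, measurable A -> mu A = nu A) ->
  energy g mu = energy g nu.
Proof.
move=> munu; rewrite /energy.
transitivity (\int[nu]_y \int[mu]_x g (x - y)%R).
  by apply: eq_measure_integral => A mA _; exact: munu.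
apply: eq_integral => y _.
by apply: eq_measure_integral => A mA _; exact: munu.
Qed.

Lemma tight_limit (nu : nat -> probability (borel_rV R N) R) (n : nat -> nat)
    (x : forall k, 'I_(n k) -> 'rV[R]_N) g (b : R) :
  (forall k, (k < n k)%N) -> (forall k, is_empirical (nu k) (x k)) -> tight nu ->
  measurable_fun [set: borel_rV R N] g -> (forall z, (- b)%:E <= g z) -> (0 <= b)%R ->
  lower_semicontinuous g -> (forall z, g z = g (- z)%R) ->
  exists2 s : nat -> nat, {homo s : m n / (m < n)%N} &
  exists2 mu, weak_star_cvg (nu \o s) mu &
    forall a : R, (\forall k \near \oo, pair_energy g (x k) <= a%:E) -> energy g mu <= a%:E.
Proof.
move=> n_ge nux tnu mg gb b0 glsc gsym.
have n_gt0 k : (0 < n k)%N by exact: leq_ltn_trans (n_ge k).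
have exp k : exists p : 'S_(n k), forall i j : 'I_(n k), (i <= j)%N ->
    (code k (x k (p i)) <= code k (x k (p j)))%N.
  exact: (sorting_perm (fun i => code k (x k i))).
pose p k := sval (cid (exp k)); have pP k := svalP (cid (exp k)).
pose y k i := x k (p k i).
have nuy k : is_empirical (nu k) (y k) by exact: is_empirical_comp_perm.
have [|s smono [C cC cvgC]] := @ae_convergent_subsequence R N n y n_gt0 pP.
  move=> eta /tnu[S [k0 k0P]]; exists S, k0 => k /k0P.
  by rewrite (empirical_ball_gt _ _ (n_gt0 k) (nuy k)).
have [X mX Xcvg] := @measurable_limit_step R N (n \o s) (fun k => y (s k)) C cC cvgC.
pose X0 : measurableTypeR R -> borel_rV R N := X.
pose mX0 := @isMeasurableFun.Build _ _ (measurableTypeR R) (borel_rV R N) X0 mX.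
pose X' : {mfun measurableTypeR R >-> borel_rV R N} := HB.pack X0 mX0.
have sk := leq_homo_ltn smono.
have n_ge' k : (k < (n \o s) k)%N by exact: leq_ltn_trans (n_ge (s k)).
have aeX : {ae unif01, forall t, step (y (s k)) t @[k --> \oo] --> (X' t : 'rV[R]_N)}.
  by move: (unif01_ae cC); apply: filterS => t [t01 Ct]; exact: Xcvg.
exists s => //; exists (distribution unif01 X').
  by apply: (weak_star_cvg_limit_law n_ge' aeX) => k; exact: nuy.
move=> a [m _ mP]; apply: (energy_limit_law n_ge' aeX mg gb b0 glsc gsym).
(* The sorted list and the original one enumerate the same measure, so the bound passes from one to
   the other through [discrete_energy]. *)
exists m => // k /= mk; rewrite -(discrete_energyE g (nuy (s k))).
rewrite (discrete_energyE g (nux (s k))); apply: mP.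
exact: leq_trans (sk k).
Qed.

End empirical.

(** * Tightness and limits of near-minimizing configurations *)

Section minimizing.
Local Open Scope ereal_scope.
Context {R : realType} {N : nat} (g : 'rV[R]_N -> \bar R) (b l : R).
Context (mg : measurable_fun [set: borel_rV R N] g).
Context (gb : forall z, (- b)%:E <= g z) (b0 : (0 <= b)%R).
Context (glsc : lower_semicontinuous g) (gsym : forall z, g z = g (- z)%R).
Context (ginfty : 0 <= limf_einf g (at_infinity R N)) (l0 : (l < 0)%R).
Context (ml : limn_einf (min_discrete_energy g) = l%:E).

Lemma near_min_lower (d : R) : (0 < d)%R ->
  exists K : nat, forall k (x : 'I_k -> 'rV[R]_N), (K <= k)%N -> (l - d)%:E <= pair_energy g x.
Proof.
move=> d0; have : (l - d)%:E < limn_einf (min_discrete_energy g).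
  by rewrite ml lte_fin gtrBl.
move=> /limn_einf_near_gt[K _ KP]; exists K.+1 => k x Kk.
apply: (le_trans (ltW (KP k _))); first exact: ltnW.
by apply: min_discrete_energy_le; exact: leq_trans Kk.
Qed.

Context (nu : nat -> probability (borel_rV R N) R) (n : nat -> nat).
Context (x : forall k, 'I_(n k) -> 'rV[R]_N).
Arguments x : clear implicits.
Context (n_ge : forall k, (k < n k)%N) (nux : forall k, is_empirical (nu k) (x k)).
Context (xl : forall e : R, (0 < e)%R -> \forall k \near \oo, pair_energy g (x k) <= (l + e)%:E).

(** The ball given by concentration depends on [eta], while one translation must serve all [eta].
    Centres are fixed at level [1 / 3]: a ball holding more than two thirds of the points meets any
    other such ball, so enlarging the radius to [S1 + 2 * S2] covers the second one. *)
Lemma tight_translates : exists y : nat -> 'rV[R]_N, tight (fun k => translate (y k) (nu k)).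
Proof.
have n_gt0 k : (0 < n k)%N by exact: leq_ltn_trans (n_ge k).
have conc (eta : R) : (0 < eta)%R -> exists (S : R) k0, forall k, (k0 <= k)%N ->
    exists y : 'rV[R]_N, ((1 - eta) * (n k)%:R < #|[set i | (`|x k i - y| <= S)%R]%SET|%:R)%R.
  move=> eta0; have [d d0 [S [n0 Sn0]]] := concentration gb ginfty l0 near_min_lower eta0.
  have [k0 _ k0P] := xl d0; exists S, (maxn k0 n0) => k; rewrite geq_max => /andP[k0k n0k].
  by apply: Sn0; [exact: leq_trans (ltnW (n_ge k))|exact: k0P].
have [|S1 [k1 P1]] := conc (1 / 3)%R; first lra.
have /choice[y yP] : forall k, exists y : 'rV[R]_N, (k1 <= k)%N ->
    ((1 - 1 / 3 : R) * (n k)%:R < #|[set i | (`|x k i - y| <= S1)%R]%SET|%:R)%R.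
  move=> k; have [k1k|kk1] := leqP k1 k; first by have [y yP] := P1 k k1k; exists y.
  by exists 0%R.
exists y => eta eta0; pose eta' := Num.min eta (1 / 3)%R.
have eta'0 : (0 < eta')%R by rewrite lt_min eta0 /=; lra.
have [S2 [k2 P2]] := conc eta' eta'0.
exists (S1 + (S2 + S2))%R, (maxn k1 k2) => k; rewrite geq_max => /andP[k1k k2k].
rewrite (empirical_ball_gt _ _ (n_gt0 k) (is_empirical_translate (y k) (nux k))).
have [y2 y2P] := P2 k k2k; have {}yP := yP k k1k.
set A := [set i | _]%SET in yP; set B := [set i | _]%SET in y2P.
have nR : (0 < (n k)%:R :> R)%R by rewrite ltr0n.
have eta'3 : (eta' <= 1 / 3)%R by rewrite ge_min lexx orbT.
have eta'eta : (eta' <= eta)%R by rewrite ge_min lexx.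
have [i] : exists i, i \in (A :&: B)%SET.
  apply/set0Pn; rewrite -card_gt0 -(ltr0n R).
  have AB : (#|A :|: B|%SET%:R <= (n k)%:R :> R)%R by rewrite ler_nat -[leqRHS]card_ord max_card.
  have := congr1 (fun m : nat => m%:R : R)%R (cardsUI A B); rewrite !natrD => UI.
  have : ((1 - 1 / 3) * (n k)%:R <= (1 - eta') * (n k)%:R)%R.
    by rewrite ler_pM2r//; lra.
  move: nR AB UI yP y2P; lra.
rewrite !inE => /andP[iA iB].
apply: (@le_lt_trans _ _ ((1 - eta') * (n k)%:R)%R); first by rewrite ler_pM2r//; lra.
apply: (lt_le_trans y2P); rewrite ler_nat.
apply: subset_leq_card; apply/fintype.subsetP => j; rewrite !inE => jB.
have -> : (x k j - y k = (x k i - y k) + ((x k j - y2) - (x k i - y2)))%R.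
  by apply/rowP => c; rewrite !mxE; ring.
apply: (le_trans (ler_normD _ _)); apply: lerD => //.
by apply: (le_trans (ler_normB _ _)); exact: lerD.
Qed.

Lemma tight_minimizing_limit : tight nu ->
  exists2 s : nat -> nat, {homo s : m n / (m < n)%N} &
  exists2 mu, weak_star_cvg (nu \o s) mu & energy g mu <= l%:E.
Proof.
move=> tnu; have [s smono [mu numu H]] := tight_limit n_ge nux tnu mg gb b0 glsc gsym.
exists s => //; exists mu => //; apply/lee_addgt0Pr => e e0.
by rewrite -EFinD; apply: H; exact: xl.
Qed.

End minimizing.

Section assembly.
Local Open Scope ereal_scope.
Context {R : realType} {N : nat}.
Implicit Types (mu nu : probability (borel_rV R N) R) (g : 'rV[R]_N -> \bar R).

Lemma min_discrete_energy_eventually_le g (b a : R) mu :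
  measurable_fun [set: borel_rV R N] g -> (forall z, (- b)%:E <= g z) ->
  (forall z, g z = g (- z)%R) -> energy g mu < a%:E ->
  \forall n \near \oo, min_discrete_energy g n <= a%:E.
Proof.
move=> mg gb gsym Ea; have Eoo : energy g mu < +oo by rewrite (lt_le_trans Ea)// leey.
have [e [eE ea]] : exists e, energy g mu <= e%:E /\ (e < a)%R.
  move: Ea; case: (energy g mu) => [e| |] // ea; first by exists e.
  by exists (a - 1)%R; rewrite leNye gtrBl.
set C := (2 + `|fine (energy g mu)|)%R.
near=> n; have n0 : (0 < n)%N by near: n; exact: nbhs_infty_gt.
have [x xE] := pair_energy_le_energy mg gb gsym Eoo n0.
apply: (le_trans (min_discrete_energy_le g x n0)); apply: (le_trans xE).
apply: (le_trans (leeD2r _ eE)); rewrite -EFinD lee_fin -/C.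
rewrite -lerBrDl ler_pdivrMr ?ltr0n// mulrC -ler_pdivrMr ?subr_gt0//.
by near: n; exact: nbhs_infty_ger.
Unshelve. all: by end_near. Qed.

Lemma limn_einf_min_le g (b : R) mu :
  measurable_fun [set: borel_rV R N] g -> (forall z, (- b)%:E <= g z) ->
  (forall z, g z = g (- z)%R) -> limn_einf (min_discrete_energy g) <= energy g mu.
Proof.
move=> mg gb gsym.
have H (a : R) : energy g mu < a%:E -> limn_einf (min_discrete_energy g) <= a%:E.
  by move=> Ea; apply: limn_einf_le; exact: (min_discrete_energy_eventually_le mg gb gsym Ea).
case E : (energy g mu) => [e| |]; last 2 first.
- exact: leey.
- move: H; rewrite E; case: (limn_einf _) => [r| |] // H.
    by have := H (r - 1)%R (ltNyr _); rewrite lee_fin leNgt gtrBl ltr01.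
  exact: (H 0%R (ltNyr _)).
by apply/lee_addgt0Pr => d d0; apply: H; rewrite E lte_fin ltrDl.
Qed.

Lemma empirical_points g (nu : nat -> probability (borel_rV R N) R) (n : nat -> nat) (l : R) :
  (forall k, discrete_energy g (n k) (nu k) < +oo) ->
  (forall e : R, (0 < e)%R -> \forall k \near \oo, discrete_energy g (n k) (nu k) <= (l + e)%:E) ->
  exists x : forall k, 'I_(n k) -> 'rV[R]_N, (forall k, is_empirical (nu k) (x k)) /\
    forall e : R, (0 < e)%R -> \forall k \near \oo, pair_energy g (x k) <= (l + e)%:E.
Proof.
move=> nuoo nul; pose x k := sval (cid (discrete_energy_finite (nuoo k))).
have nux k : is_empirical (nu k) (x k) := svalP (cid (discrete_energy_finite (nuoo k))).
exists x; split=> // e e0; apply: filterS (nul e e0) => k.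
by rewrite (discrete_energyE g (nux k)).
Qed.

End assembly.

Local Open Scope ereal_scope.

Theorem proposition6 (R : realType) (N : nat) (g : 'rV[R]_N -> \bar R)
  (N_gt0 : (0 < N)%N)
  (g_fin : forall x, x != 0%R -> g x \is a fin_num)
  (g_0 : g 0%R != -oo)
  (g_sym : forall x, g x = g (- x)%R)
  (g_bounded_below : exists c : R, forall x, c%:E <= g x)
  (g_lsc : lower_semicontinuous g)
  (g_L1loc : locally_integrable_rV g)
  (g_infty : 0 <= limf_einf g (at_infinity R N))
  (g_neg : exists mu0 : probability (borel_rV R N) R, energy g mu0 < 0) :
  let l := limn_einf (min_discrete_energy g) in
  [/\ min_discrete_energy g n @[n --> \oo] --> l,
      l = ereal_inf (range (energy g)) &
      forall pi_ : nat -> probability (borel_rV R N) R,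
        discrete_energy g n (pi_ n) @[n --> \oo] --> l ->
        (exists y : nat -> 'rV[R]_N,
           weak_star_precompact (fun n => translate (y n) (pi_ n))) /\
        (forall (y : nat -> 'rV[R]_N) (mu : probability (borel_rV R N) R),
           weak_star_limit_point (fun n => translate (y n) (pi_ n)) mu ->
           is_energy_minimizer g mu)].
Proof.
move=> l.
have [c gc] := g_bounded_below; pose b := Num.max (- c)%R 0%R.
have b0 : (0 <= b)%R by rewrite le_max lexx orbT.
have gb z : (- b)%:E <= g z.
  by apply: le_trans (gc z); rewrite lee_fin lerNl le_max lexx.
have mg : measurable_fun [set: borel_rV R N] g by case: g_L1loc.
have lle mu : l <= energy g mu := limn_einf_min_le mu mg gb g_sym.
have [mu0 mu0E] := g_neg.
have lge : (- b)%:E <= l.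
  apply: limn_einf_ge => a ab; apply: nearW => n; apply: (le_trans (ltW ab)).
  by apply: le_ereal_inf_tmp => _ [nu _ <-]; exact: discrete_energy_ge.
have lfin : l \is a fin_num.
  rewrite fin_real// (lt_le_trans (ltNyr _) lge) (le_lt_trans (lle mu0))//.
  exact: lt_trans mu0E (ltry _).
pose lr := fine l; have lE : l = lr%:E by rewrite fineK.
have lr0 : (lr < 0)%R by rewrite -lte_fin -lE; exact: le_lt_trans mu0E.
have ml : limn_einf (min_discrete_energy g) = lr%:E by exact: lE.
have translates := @tight_translates R N g b lr gb g_infty lr0 ml.
have limit := @tight_minimizing_limit R N g b lr mg gb b0 g_lsc g_sym.
have [mu muE] : exists mu, energy g mu <= l.
  have /choice[n nP] : forall k, exists n, (k < n)%N /\
      min_discrete_energy g n < (lr + k.+1%:R^-1)%:E.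
    move=> k; have [|n kn nl] := @limn_einf_frequently_lt _ (min_discrete_energy g)
      (lr + k.+1%:R^-1)%:E _ k.+1; last by exists n.
    by rewrite ml lte_fin ltrDl invr_gt0.
  have /choice[nu nuP] : forall k, exists nu,
      discrete_energy g (n k) nu < (lr + k.+1%:R^-1)%:E.
    by move=> k; have [_ /ereal_inf_lt[_ [nu _ <-] nul]] := nP k; exists nu.
  have [k|e e0|x [nux xl]] := @empirical_points R N g nu n lr.
  - exact: lt_trans (nuP k) (ltry _).
  - near=> k; apply: (le_trans (ltW (nuP k))); rewrite lee_fin lerD2l ltW//.
    by near: k; exact: near_infty_natSinv_lt (PosNum e0).
  have n_ge k : (k < n k)%N by case: (nP k).
  have [y ty] := translates nu n x n_ge nux xl.
  have [|s _ [mu _ muE]] := limit _ n (fun k i => x k i - y k)%R n_ge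
    (fun k => is_empirical_translate (y k) (nux k)) _ ty; last first.
    by exists mu; rewrite lE.
  by move=> e /xl; apply: filterS => k; rewrite pair_energy_translate.
have mu_min : energy g mu = l by apply/eqP; rewrite eq_le muE lle.
have minimizer nu : energy g nu <= l -> is_energy_minimizer g nu.
  by move=> nul mu'; exact: le_trans (lle mu').
split.
- rewrite lE; apply: cvge_squeeze => e e0; near=> n; apply/andP; split.
    apply: ltW; near: n; apply: limn_einf_near_gt.
    by rewrite ml lte_fin gtrBl.
  near: n; apply: (min_discrete_energy_eventually_le mg gb g_sym (mu := mu)).
  by rewrite mu_min lE lte_fin ltrDl.
- apply/eqP; rewrite eq_le; apply/andP; split.
    by apply: le_ereal_inf_tmp => _ [nu _ <-]; exact: lle.
  by rewrite -mu_min; apply: ereal_inf_lbound; exists mu.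
move=> pi_ pil.
have pil' (e : R) : (0 < e)%R -> \forall n \near \oo, discrete_energy g n (pi_ n) <= (lr + e)%:E.
  move=> e0; have : \forall n \near \oo, discrete_energy g n (pi_ n) < (lr + e)%:E.
    by apply: (cvge_near_lt pil); rewrite lE lte_fin ltrDl.
  by apply: filterS => n; exact: ltW.
have [n1 _ n1P] := pil' 1%R ltr01.
have tail_fin k : (n1 < k)%N -> discrete_energy g k (pi_ k) < +oo.
  by move=> n1k; apply: le_lt_trans (n1P k _) (ltry _); exact: ltnW.
(* [pi_ k] is known to be empirical only from some rank on. The shift by [n1.+1] discards the other
   terms and also makes the number of points exceed the index strictly. *)
have tail (s : nat -> nat) : {homo s : m n / (m < n)%N} ->
    exists x : forall k, 'I_(s (k + n1.+1)%N) -> 'rV[R]_N,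
      (forall k, is_empirical (pi_ (s (k + n1.+1)%N)) (x k)) /\
      forall e : R, (0 < e)%R -> \forall k \near \oo, pair_energy g (x k) <= (lr + e)%:E.
  move=> smono; apply: empirical_points => [k|e e0].
    apply: tail_fin; apply: leq_trans (leq_homo_ltn smono _).
    by rewrite addnS ltnS leq_addl.
  have [m _ mP] := pil' e e0; exists m => // k /= mk; apply: mP => /=.
  by apply: leq_trans (leq_homo_ltn smono _); rewrite (leq_trans mk)// leq_addr.
have tail_ge (s : nat -> nat) : {homo s : m n / (m < n)%N} ->
    forall k, (k < s (k + n1.+1))%N.
  by move=> smono k; apply: leq_trans (leq_homo_ltn smono _); rewrite addnS ltnS leq_addr.
have idmono : {homo (@id nat) : m n / (m < n)%N} by [].
have tail_limit (s : nat -> nat) (y : nat -> 'rV[R]_N) : {homo s : m n / (m < n)%N} ->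
    tight (fun k => translate (y (s (k + n1.+1)%N)) (pi_ (s (k + n1.+1)%N))) ->
    exists2 t : nat -> nat, {homo t : m n / (m < n)%N} &
    exists2 nu, weak_star_cvg
        ((fun k => translate (y (s (k + n1.+1)%N)) (pi_ (s (k + n1.+1)%N))) \o t) nu
      & energy g nu <= l.
  move=> smono ty; have [x [nux xl]] := tail s smono.
  rewrite lE; apply: (limit _ _ (fun k i => x k i - y (s (k + n1.+1)%N))%R (tail_ge s smono)) => //.
    by move=> k; exact: is_empirical_translate.
  by move=> e /xl; apply: filterS => k; rewrite pair_energy_translate.
split.
  have [x [nux xl]] := tail id idmono.
  have [y ty] := translates _ _ x (tail_ge id idmono) nux xl.
  (* The translations were found for the shifted sequence; [y'] reindexes them, and its values below
     rank [n1.+1] are irrelevant. *)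
  pose y' n := y (n - n1.+1)%N; exists y' => s smono.
  have [|t tmono [nu nuP _]] := tail_limit s y' smono.
    move=> eta /ty[S [k0 k0P]]; exists S, k0 => k k0k; rewrite /y'.
    set m := s (k + n1.+1)%N.
    have km : (k + n1.+1 <= m)%N by exact: leq_homo_ltn.
    have nm : (n1.+1 <= m)%N by apply: leq_trans km; exact: leq_addl.
    have := k0P (m - n1.+1)%N; rewrite subnK//; apply.
    by rewrite leq_subRL// addnC (leq_trans _ km)// leq_add2r.
  exists nu; exists (fun k => t k + n1.+1)%N => //.
  by move=> i j ij; rewrite ltn_add2r; exact: tmono.
move=> y nu [s smono snu]; apply: minimizer.
(* The translations of a limit point are arbitrary, so tightness comes from convergence itself.
   Extraction then gives a limit of energy at most [l], which agrees with [nu] by uniqueness. *)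
pose tr k := translate (y (s (k + n1.+1)%N)) (pi_ (s (k + n1.+1)%N)).
have trnu : weak_star_cvg tr nu.
  move=> phi cphi cpt; have := snu phi cphi cpt.
  by rewrite -(cvg_shiftn n1.+1).
have [t tmono [nu' nu'P nu'E]] := tail_limit s y smono (weak_star_cvg_tight trnu).
have tnu : weak_star_cvg (tr \o t) nu.
  move=> phi cphi cpt; apply: (cvg_comp _ _ _ (trnu phi cphi cpt)).
  move=> A [m _ mA]; exists m => // k /= mk; apply: mA => /=.
  by apply: (leq_trans mk); exact: leq_homo_ltn.
rewrite (energy_eq g (weak_star_cvg_unique tnu nu'P)).
exact: nu'E.
Unshelve. all: by end_near. Qed.
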